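(* Consider the Toda lattice $H_{Toda}(p,q)=\frac12\sum_{j=0}^{N-1}p_j^2+\sum_{j=0}^{N-1}e^{q_j-q_{j+1}}$ with periodic boundary conditions $q_N=q_0$, $p_N=p_0$, on the subspace $\sum_jq_j=0=\sum_jp_j$, and put $\mu:=1/N$. Fix $\sigma>0$. Then there exist constants $R_0,C_1>0$, independent of $N$, such that the following holds for all $N\ge 2$. Consider a real initial datum with $$\mathcal E_1(0)=\mathcal E_{N-1}(0)=R^2e^{-2\sigma}\mu^4,\qquad \mathcal E_k(0)=0\quad\forall k\ne1,N-1,$$ with $0<R<R_0$. Then, along the corresponding solution, one has $$\mathcal E_k(t)\le R^2(1+C_1R)\,\mu^4e^{-2\sigma k},\qquad\forall\,1\le k\le\lfloor N/2\rfloor,\quad\forall t\in\mathbb R.$$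
   Context: Discrete Fourier transform: $\hat q_k=\frac1{\sqrt N}\sum_{j=0}^{N-1}q_je^{2\pi \mathrm i jk/N}$, similarly $\hat p_k$. $\omega(k/N)=2\sin(k\pi/N)$. Energy of the $k$-th normal mode: $E_k=\frac{|\hat p_k|^2+\omega(k/N)^2|\hat q_k|^2}2$ for $1\le k\le N-1$; specific energy $\mathcal E_k=E_k/N$. For real $(p,q)$ one has $\mathcal E_k=\mathcal E_{N-k}$. $\mathcal E_k(t)$ is the value along the solution at time $t$ of Hamilton's equations $\dot q_j=\partial H/\partial p_j$, $\dot p_j=-\partial H/\partial q_j$. *)

(* Defs.v *)
From HB Require Import structures.
From mathcomp Require Import all_boot all_order all_algebra.
From mathcomp Require Import all_classical all_reals all_analysis.
From mathcomp Require Export complex.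

Set Implicit Arguments.
Unset Strict Implicit.
Unset Printing Implicit Defensive.

Import Order.TTheory GRing.Theory Num.Theory.
Import numFieldNormedType.Exports.

Local Open Scope ring_scope.
Local Open Scope complex_scope.

(* Only Hamiltonians differentiable everywhere are meant: the partial
   derivatives of H are given by the total operator 'D_v. *)
Definition hamilton_solution (R : realType) (N : nat)
    (H : 'rV[R]_N -> 'rV[R]_N -> R) (p q : R -> 'rV[R]_N) : Prop :=
  forall (t : R) (j : 'I_N),
    is_derive t 1 (fun s => q s 0 j)
      ('D_(delta_mx 0 j) (fun y : 'rV[R]_N => H y (q t)) (p t)) /\
    is_derive t 1 (fun s => p s 0 j)
      (- 'D_(delta_mx 0 j) (fun x : 'rV[R]_N => H (p t) x) (q t)).

(* [ordS j] is j + 1 modulo N, which encodes q_N = q_0. *)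
Definition toda_hamiltonian (R : realType) (N : nat) (p q : 'rV[R]_N) : R :=
  2^-1 * \sum_(j < N) p 0 j ^+ 2 + \sum_(j < N) expR (q 0 j - q 0 (ordS j)).

Definition cis (R : realType) (theta : R) : R[i] := cos theta +i* sin theta.

Definition dft (R : realType) (N : nat) (u : 'rV[R]_N) (k : nat) : R[i] :=
  ((Num.sqrt N%:R)^-1)%:C *
  \sum_(j < N) (u 0 j)%:C * cis (2 * pi * j%:R * k%:R / N%:R).

Definition mode_frequency (R : realType) (N k : nat) : R :=
  2 * sin (k%:R * pi / N%:R).

Definition mode_energy (R : realType) (N : nat) (p q : 'rV[R]_N) (k : nat) : R :=
  (ComplexField.Normc.normc (dft p k) ^+ 2
   + mode_frequency R N k ^+ 2 * ComplexField.Normc.normc (dft q k) ^+ 2) / 2.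

Definition specific_energy (R : realType) (N : nat) (p q : 'rV[R]_N)
    (k : nat) : R :=
  mode_energy p q k / N%:R.

(* Main.v *)
(** In Flaschka's variables the Toda flow is a Lax flow, so the spectra of the
    periodic and antiperiodic Jacobi matrices are conserved.  In a Bloch basis the
    n-th pair of free eigenvalues is split, to first order, by the combination
    eta_n = p^_n - i w_n q^_n, and |eta_n|^2 + |eta_(N-n)|^2 = 4 E_n / N.  A Feshbach
    reduction onto this pair, run in the norms weighted by exp(-sigma |i - j|),
    shows that the splitting equals 2 |eta_n| up to an error of order
    r^2 N^-2 exp(-sigma n): the small divisors are at least of order N^-2 and
    their inverses are summable to O(N^2).  Comparing the splittings at times 0
    and t bounds every |eta_n(t)| by |eta_n(0)| plus this error as long as the
    weighted norm of eta stays of size r, and a continuity argument removes this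
    last proviso. *)

Require Import Defs.
From HB Require Import structures.
From mathcomp Require Import all_boot all_order all_algebra.
From mathcomp Require Import all_classical all_reals all_analysis.
From mathcomp Require Import perm ring lra zify.

Set Implicit Arguments.
Unset Strict Implicit.
Unset Printing Implicit Defensive.

Import Order.TTheory GRing.Theory Num.Theory.
Import numFieldNormedType.Exports.

Local Open Scope ring_scope.
Local Open Scope complex_scope.

Local Notation normc := ComplexField.Normc.normc.

(** * Moduli of complex numbers *)

(** The scale [mu ^ 4] comes from the small divisors. A specific energy of order [r ^ 2 mu ^ 4]
    means Fourier coefficients of order [c = r / N ^ 2], while the inverse divisors sum to order
    [N ^ 2]. The product, of order [r], is the small parameter, and the second-order correction
    [c ^ 2 N ^ 2] is smaller than [c] by this factor, uniformly in [N]. Decay in the mode number is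
    read as decay of matrix entries away from the diagonal: the Bloch basis for the pair [n] carries
    a twist depending on [n], chosen so that the resonant pair sits at the indices [0] and [n]. The
    weight is submultiplicative, so it survives both matrix products and the reduction. The reduced
    2x2 problem depends on the spectral parameter. Its eigenvalues are neither counted nor labelled:
    any two eigenvalues in the window obey an upper estimate on their distance, some two obey a
    lower one, and this suffices to compare isospectral matrices. *)

Section ComplexModulus.
Context {R : rcfType}.
Implicit Types (z w : R[i]) (x y : R).

Lemma normcE_norm z : (normc z)%:C = `|z|.
Proof. by case: z. Qed.

Lemma normc_ge0 z : 0 <= normc z.
Proof. by rewrite -ler0c normcE_norm normr_ge0. Qed.

Lemma normcD_le z w : normc (z + w) <= normc z + normc w.
Proof. by rewrite -lecR rmorphD /= !normcE_norm ler_normD. Qed.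

Lemma normc_opp z : normc (- z) = normc z.
Proof. by apply: complexI; rewrite !normcE_norm normrN. Qed.

Lemma normcM z w : normc (z * w) = normc z * normc w.
Proof. exact: ComplexField.Normc.normcM. Qed.

Lemma normc_conj z : normc (conjc z) = normc z.
Proof. by case: z => a b /=; rewrite sqrrN. Qed.

Lemma normc_real x : normc x%:C = `|x|.
Proof. by rewrite /= expr0n addr0 sqrtr_sqr. Qed.

Lemma normc_sub z w : normc (z - w) = normc (w - z).
Proof. by rewrite -normc_opp opprB. Qed.

Lemma normc_eq0 z : normc z = 0 -> z = 0.
Proof. exact: ComplexField.Normc.eq0_normc. Qed.

Lemma normc_sum (I : Type) (r : seq I) (P : pred I) (F : I -> R[i]) :
  normc (\sum_(i <- r | P i) F i) <= \sum_(i <- r | P i) normc (F i).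
Proof.
elim/big_rec2: _ => [|i y z _ le_zy]; first by rewrite ComplexField.Normc.normc0.
by rewrite (le_trans (normcD_le _ _))// lerD2l.
Qed.

Lemma normc_dist z w : `|normc z - normc w| <= normc (z - w).
Proof.
rewrite ler_norml; apply/andP; split.
- have := normcD_le (w - z) z; rewrite subrK normc_sub; lra.
- have := normcD_le (z - w) w; rewrite subrK; lra.
Qed.

Lemma mulc_conj z : z * conjc z = (normc z ^+ 2)%:C.
Proof. by rewrite -sqr_normc -normcE_norm -rmorphXn. Qed.

Lemma normc_sqr z : normc z ^+ 2 = complex.Re z ^+ 2 + complex.Im z ^+ 2.
Proof. by case: z => a b /=; rewrite sqr_sqrtr ?addr_ge0 ?sqr_ge0. Qed.

Lemma real_complexB x y : (x - y)%:C = x%:C - y%:C :> R[i].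
Proof. exact: (rmorphB (real_complex R)). Qed.

Lemma real_complexD x y : (x + y)%:C = x%:C + y%:C :> R[i].
Proof. exact: (rmorphD (real_complex R)). Qed.

Lemma real_complexM x y : (x * y)%:C = x%:C * y%:C :> R[i].
Proof. exact: (rmorphM (real_complex R)). Qed.

Lemma conjcD z w : conjc (z + w) = conjc z + conjc w.
Proof. exact: (rmorphD (@conjc R)). Qed.

Lemma conjcB z w : conjc (z - w) = conjc z - conjc w.
Proof. exact: (rmorphB (@conjc R)). Qed.

Lemma conjcM z w : conjc (z * w) = conjc z * conjc w.
Proof. exact: (rmorphM (@conjc R)). Qed.

Lemma conjc_sum (I : Type) (r : seq I) (P : pred I) (F : I -> R[i]) :
  conjc (\sum_(i <- r | P i) F i) = \sum_(i <- r | P i) conjc (F i).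
Proof. exact: (rmorph_sum (@conjc R)). Qed.

Lemma conjc_fixed z : conjc z = z -> z = (complex.Re z)%:C.
Proof. by case: z => a b [] /= hb; congr Complex; lra. Qed.

End ComplexModulus.

(** * Feshbach reduction on a pair of resonant modes *)

Section Feshbach.
Context {R : realType} {n : nat}.
Variables (A : 'M[R[i]]_n) (D : 'I_n -> R) (d S rho : R).
Variables (w : 'I_n -> 'I_n -> R) (u v : 'I_n) (s : 'I_n -> 'I_n).

Local Notation V i j := (A i j - (D i *+ (i == j))%:C).
Local Notation Q i := ((i != u) && (i != v)).

(* The involution [s] is induced by complex conjugation on Bloch modes: [gs_sym] forces
   the two diagonal entries of the 2x2 Schur complement on [u], [v] to agree, so that its
   two eigenvalue branches differ by twice the modulus of the off-diagonal entry. *)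
Record gap_setting : Prop := GapSetting {
  gs_S : 0 < S;
  gs_rho : 0 <= rho;
  gs_small : 8 * (rho * S) <= 1;
  gs_uv : u != v;
  gs_Du : D u = d;
  gs_Dv : D v = d;
  gs_sK : involutive s;
  gs_su : s u = v;
  gs_herm : forall i j, A j i = conjc (A i j);
  gs_sym : forall i j, A (s i) (s j) = conjc (A i j);
  gs_w0 : forall i j, 0 < w i j;
  gs_w1 : forall i j, w i j <= 1;
  gs_wii : forall i, w i i = 1;
  gs_wM : forall i j k, w i j * w j k <= w i k;
  gs_V : forall i j, normc (V i j) <= rho * w i j;
  gs_D : forall i, Q i -> D i != d;
  gs_sum : \sum_(i | Q i) `|D i - d|^-1 <= S }.

Hypothesis gs : gap_setting.

Local Notation win lam := (`|lam - d| <= (2 * S)^-1).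

Definition reduced_system (lam : R) (x f : 'I_n -> R[i]) : Prop :=
  forall i, Q i -> (D i - lam)%:C * x i + \sum_(l | Q l) V i l * x l = f i.

(** Each [|D i - d|] is at least [1 / S], its inverse being one term of a sum bounded by [S]. The
    window has half that radius, so moving from [d] to [lam] at most halves a divisor. *)
Lemma window_dist (lam : R) i : win lam -> Q i ->
  0 < `|D i - d| /\ `|D i - d| <= 2 * `|D i - lam|.
Proof.
move=> hlam Qi; have dgt0 : 0 < `|D i - d| by rewrite normr_gt0 subr_eq0 gs_D.
split=> //.
have hS : `|D i - d|^-1 <= S.
  apply: le_trans (gs_sum gs).
  by rewrite (bigD1 i) //= lerDl sumr_ge0 // => j _; rewrite invr_ge0.
have {}hS : S^-1 <= `|D i - d| by rewrite invf_ple ?posrE ?(gs_S gs).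
have : `|D i - d| <= `|D i - lam| + `|lam - d|.
  by rewrite (le_trans _ (ler_normD _ _)) // addrA subrK.
move: hlam; rewrite invfM; have := gs_S gs; lra.
Qed.

(* The weighted l1 norm makes the perturbation contribute only through
   w(i,l) w(l,e) <= w(i,e), so the small divisors need only be summable. *)
Lemma reduced_bound (lam phi : R) (x f : 'I_n -> R[i]) e :
  win lam -> 0 <= phi -> reduced_system lam x f ->
  (forall i, Q i -> normc (f i) <= phi * w i e) ->
  \sum_(i | Q i) normc (x i) / w i e <= 4 * S * phi.
Proof.
move=> hlam ph0 hx hf; set X := \sum_(i | Q i) _.
have hrow i : Q i -> normc (x i) / w i e <= `|D i - d|^-1 * (2 * (phi + rho * X)).
  move=> Qi; have [dgt0 hd] := window_dist hlam Qi.
  have wgt0 := gs_w0 gs i e.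
  have eq1 : (D i - lam)%:C * x i = f i - \sum_(l | Q l) V i l * x l.
    by rewrite -(hx i Qi) addrK.
  have hsum : normc (\sum_(l | Q l) V i l * x l) <= rho * X * w i e.
    apply: le_trans (normc_sum _ _ _) _; rewrite mulrAC mulr_sumr ler_sum // => l Ql.
    rewrite normcM; have wl := gs_w0 gs l e.
    rewrite [leRHS]mulrCA [leLHS]mulrC ler_wpM2l ?normc_ge0 //.
    rewrite ler_pdivlMr //; apply: le_trans (_ : rho * w i l * w l e <= _).
      by rewrite ler_wpM2r ?(ltW wl) ?(gs_V gs).
    by rewrite -mulrA ler_wpM2l ?(gs_rho gs) ?(gs_wM gs).
  have : `|D i - lam| * normc (x i) <= (phi + rho * X) * w i e.
    rewrite -normc_real -normcM eq1 (le_trans (normcD_le _ _)) // normc_opp.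
    by rewrite mulrDl lerD // hf.
  move=> h1; rewrite ler_pdivrMr // -mulrA ler_pdivlMl //.
  have := normc_ge0 (x i); nra.
have X0 : 0 <= X.
  by apply: sumr_ge0 => i _; rewrite divr_ge0 ?normc_ge0 ?(ltW (gs_w0 gs _ _)).
have hX : X <= S * (2 * (phi + rho * X)).
  apply: le_trans (ler_sum _ hrow) _; rewrite -mulr_suml ler_wpM2r ?(gs_sum gs) //.
  by rewrite mulr_ge0 // addr_ge0 // mulr_ge0 ?(gs_rho gs).
(* As [2 rho S <= 1 / 4], the term in [X] on the right of [hX] is absorbed on the left. *)
have h1 : 0 <= (1 - 8 * (rho * S)) * X by rewrite mulr_ge0 // subr_ge0 (gs_small gs).
have h2 : 0 <= S * phi by rewrite mulr_ge0 // ltW ?(gs_S gs).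
clearbody X; lra.
Qed.

(** The difference of two solutions solves the homogeneous system, and [reduced_bound] with
    [phi = 0] makes it vanish. *)
Lemma reduced_unique (lam : R) (x y f : 'I_n -> R[i]) :
  win lam -> reduced_system lam x f -> reduced_system lam y f ->
  forall i, Q i -> x i = y i.
Proof.
move=> hlam hx hy i Qi.
have hz : reduced_system lam (fun i => x i - y i) (fun _ => 0).
  move=> j Qj /=.
  have -> : \sum_(l | Q l) V j l * (x l - y l) =
      \sum_(l | Q l) V j l * x l - \sum_(l | Q l) V j l * y l.
    by rewrite -sumrB; apply: eq_bigr => l _; rewrite mulrBr.
  have := hx j Qj; rewrite -(hy j Qj) => h; rewrite mulrBr addrACA h.
  by ring.
have hf j : Q j -> normc (0 : R[i]) <= 0 * w j u.
  by rewrite mul0r ComplexField.Normc.normc0.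
have := reduced_bound hlam (lexx 0) hz hf; rewrite mulr0 => h.
have : normc (x i - y i) / w i u <= 0.
  apply: le_trans h; rewrite (bigD1 i) //= lerDl sumr_ge0 // => j _.
  by rewrite divr_ge0 ?normc_ge0 ?(ltW (gs_w0 gs _ _)).
rewrite pmulr_lle0 ?invr_gt0 ?(gs_w0 gs) // => h1.
by apply/eqP; rewrite -subr_eq0; apply/eqP/normc_eq0/le_anti; rewrite h1 normc_ge0.
Qed.

Lemma reduced_exists (lam : R) (f : 'I_n -> R[i]) :
  win lam -> exists x, reduced_system lam x f /\ forall i, ~~ Q i -> x i = 0.
Proof.
move=> hlam.
(* Extended by the identity on [u] and [v], the block on [Q] becomes a square matrix on all indices,
   invertible because uniqueness makes it injective. *)
pose M : 'M[R[i]]_n := \matrix_(i, j)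
  if Q i then (if Q j then A i j - lam%:C *+ (i == j) else 0) else (i == j)%:R.
have MQ (x : 'I_n -> R[i]) i : Q i -> \sum_j M i j * x j =
    (D i - lam)%:C * x i + \sum_(l | Q l) V i l * x l.
  move=> Qi; rewrite (bigID (fun j => Q j)) /= [X in _ + X]big1 ?addr0; last first.
    by move=> j /negbTE nQj; rewrite mxE Qi nQj mul0r.
  rewrite (eq_bigr (fun l => V i l * x l + (D i - lam)%:C *+ (i == l) * x l)); last first.
    move=> l Ql; rewrite mxE Qi Ql -mulrDl; congr (_ * _).
    by case: (i == l); rewrite ?mulr1n ?mulr0n /= ?rmorphB /=; ring.
  rewrite big_split /= addrC; congr (_ + _).
  rewrite (bigD1 i) //= eqxx mulr1n big1 ?addr0 // => l /andP[_ /negbTE].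
  by rewrite eq_sym => ->; rewrite mulr0n mul0r.
have MN (x : 'I_n -> R[i]) i : ~~ Q i -> \sum_j M i j * x j = x i.
  move=> /negbTE nQi; rewrite (bigD1 i) //= mxE nQi eqxx mul1r big1 ?addr0 // => j.
  by rewrite eq_sym => /negbTE nij; rewrite mxE nQi nij mul0r.
have Mu : M \in unitmx.
  rewrite unitmxE unitfE -det_tr; apply/negP => /det0P[z znz zM].
  have Mz i : \sum_j M i j * z 0 j = 0.
    have := congr1 (fun B : matrix _ _ _ => B 0 i) zM; rewrite mxE [RHS]mxE => h; rewrite -[RHS]h.
    by apply: eq_bigr => j _; rewrite !mxE mulrC.
  have z0 i : z 0 i = 0.
    have [Qi|nQi] := boolP (Q i); last by rewrite -(MN _ _ nQi).
    apply: (@reduced_unique lam (fun i => z 0 i) (fun _ => 0) (fun _ => 0)) => //.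
      by move=> j Qj; rewrite -MQ.
    by move=> j Qj; rewrite mulr0 add0r big1 // => l _; rewrite mulr0.
  by move/eqP: znz; apply; apply/rowP => i; rewrite z0 mxE.
pose b : 'cV[R[i]]_n := \col_i (if Q i then f i else 0).
pose X := invmx M *m b.
have MX i : \sum_j M i j * X j 0 = b i 0.
  by rewrite -[b](mulKVmx Mu) mxE.
exists (fun i => X i 0); split=> i Qi.
- by rewrite -(MQ (fun i => X i 0)) // MX mxE Qi.
- by rewrite -(MN (fun i => X i 0)) // MX mxE (negbTE Qi).
Qed.


Lemma sum_split (F : 'I_n -> R[i]) :
  \sum_j F j = F u + F v + \sum_(j | Q j) F j.
Proof.
rewrite (bigD1 u) //= (bigD1 v) /= ?addrA //; first by rewrite eq_sym (gs_uv gs).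
Qed.

Lemma reduced_systemE (lam : R) (x : 'I_n -> R[i]) i : Q i ->
  (D i - lam)%:C * x i + \sum_(l | Q l) V i l * x l =
  \sum_(l | Q l) A i l * x l - lam%:C * x i.
Proof.
move=> Qi; rewrite (eq_bigr (fun l => A i l * x l - (D i *+ (i == l))%:C * x l)); last first.
  by move=> l _; rewrite mulrBl.
have -> : \sum_(l | Q l) (A i l * x l - (D i *+ (i == l))%:C * x l) =
    \sum_(l | Q l) A i l * x l - (D i)%:C * x i.
  rewrite sumrB; congr (_ - _).
  rewrite (bigD1 i) //= eqxx mulr1n big1 ?addr0 // => l /andP[_ /negbTE].
  by rewrite eq_sym => ->; rewrite mulr0n mul0r.
by rewrite rmorphB /=; ring.
Qed.

Lemma det_eigen (lam : R) :
  reflect (exists2 z : 'I_n -> R[i], exists i, z i != 0 &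
             forall i, \sum_j A i j * z j = lam%:C * z i)
          (\det (A - lam%:C%:M) == 0).
Proof.
have key (z : 'rV[R[i]]_n) i :
    (z *m (A - lam%:C%:M)^T) 0 i = \sum_j A i j * z 0 j - lam%:C * z 0 i.
  rewrite linearB /= tr_scalar_mx mulmxBr mul_mx_scalar !mxE; congr (_ - _).
  by apply: eq_bigr => j _; rewrite mxE mulrC.
rewrite -det_tr; apply: (iffP det0P) => [[z znz zA]|[z [i zi] zA]].
- exists (fun i => z 0 i).
    by move/rV0Pn: znz => [i zi]; exists i.
  move=> i; apply/eqP; rewrite -subr_eq0 -key zA mxE //.
- exists (\row_i z i); first by apply/rV0Pn; exists i; rewrite mxE.
  apply/rowP => j; rewrite key mxE [RHS]mxE.
  by apply/eqP; rewrite subr_eq0 -zA; apply/eqP; apply: eq_bigr => l _; rewrite mxE.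
Qed.

(** The [Q] part of the vector that extends the basis vector at [e] to a solution of the rows of
    [(A - lam) z = 0] indexed by [Q]. *)
Definition corrector (lam : R) (e : 'I_n) (x : 'I_n -> R[i]) : Prop :=
  reduced_system lam x (fun i => - A i e) /\ forall i, ~~ Q i -> x i = 0.

Lemma feshbach_det (lam a : R) (b : R[i]) xu xv :
  win lam -> corrector lam u xu -> corrector lam v xv ->
  A u u + \sum_(l | Q l) A u l * xu l = a%:C ->
  A u v + \sum_(l | Q l) A u l * xv l = b ->
  A v u + \sum_(l | Q l) A v l * xu l = conjc b ->
  A v v + \sum_(l | Q l) A v l * xv l = a%:C ->
  (\det (A - lam%:C%:M) == 0) = (`|a - lam| == normc b).
Proof.
move=> hlam [hu nu] [hv nv] huu huv hvu hvv.
have nQu : ~~ Q u by rewrite eqxx.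
have nQv : ~~ Q v by rewrite eqxx andbF.
have rowE (z : 'I_n -> R[i]) e : (forall l, Q l -> z l = xu l * z u + xv l * z v) ->
    \sum_j A e j * z j = (A e u + \sum_(l | Q l) A e l * xu l) * z u +
                         (A e v + \sum_(l | Q l) A e l * xv l) * z v.
  move=> hz; rewrite sum_split !mulrDl addrACA; congr (_ + _).
  rewrite !mulr_suml -big_split /=; apply: eq_bigr => l Ql.
  by rewrite hz //; ring.
apply/det_eigen/eqP => [[z [i0 zi0] zA]|hab].
- have hz l : Q l -> z l = xu l * z u + xv l * z v.
    have hz1 : reduced_system lam z (fun i => - (A i u * z u + A i v * z v)).
      move=> i Qi; rewrite reduced_systemE //.
      have := zA i; rewrite sum_split => <-; ring.
    apply: (@reduced_unique lam z (fun l => xu l * z u + xv l * z v) _ hlam hz1).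
    move=> i Qi.
    have e1 := hu i Qi; have e2 := hv i Qi; rewrite !reduced_systemE // in e1 e2 *.
    rewrite (eq_bigr (fun l => A i l * xu l * z u + A i l * xv l * z v)); last first.
      by move=> j _; ring.
    rewrite big_split /= -!mulr_suml.
    have -> : \sum_(j | Q j) A i j * xu j = lam%:C * xu i - A i u by rewrite -e1; ring.
    have -> : \sum_(j | Q j) A i j * xv j = lam%:C * xv i - A i v by rewrite -e2; ring.
    ring.
  have e1 := zA u; have e2 := zA v; rewrite !rowE // huu huv hvu hvv in e1 e2.
  have f1 : (a - lam)%:C * z u = - (b * z v).
    by rewrite rmorphB mulrBl -e1; ring.
  have f2 : (a - lam)%:C * z v = - (conjc b * z u).
    by rewrite rmorphB mulrBl -e2; ring.
  have {f1} f1 : `|a - lam| * normc (z u) = normc b * normc (z v).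
    by rewrite -normc_real -!normcM f1 normc_opp.
  have {f2} f2 : `|a - lam| * normc (z v) = normc b * normc (z u).
    by rewrite -normc_real -[in RHS]normc_conj -!normcM f2 normc_opp.
  (* By [hz] a kernel vector vanishing on [u] and [v] would vanish altogether. So the sum of the two
     equalities of moduli may be divided by this factor. *)
  have zuv : 0 < normc (z u) + normc (z v).
    rewrite lt_neqAle addr_ge0 ?normc_ge0 // andbT eq_sym paddr_eq0 ?normc_ge0 //.
    apply: contra zi0 => /andP[/eqP/normc_eq0 zu0 /eqP/normc_eq0 zv0].
    have [Qi|nQi] := boolP (Q i0); first by rewrite hz // zu0 zv0 !mulr0 addr0.
    by move: nQi; rewrite negb_and !negbK => /orP[] /eqP ->; rewrite ?zu0 ?zv0.
  apply: (mulIf (lt0r_neq0 zuv)); rewrite !mulrDr f1 f2 addrC //.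
(* The kernel vector of the 2x2 matrix is [(- b, a - lam)]; it vanishes when [b = 0], since then
   [a = lam], and [(1, 0)] takes its place. *)
- pose zu : R[i] := if b == 0 then 1 else - b.
  pose zv : R[i] := if b == 0 then 0 else (a - lam)%:C.
  have hz1 : (a - lam)%:C * zu + b * zv = 0 /\ conjc b * zu + (a - lam)%:C * zv = 0.
    rewrite /zu /zv; have [b0|b0] := eqVneq b 0.
      move: hab; rewrite b0 ComplexField.Normc.normc0 => /eqP; rewrite normr_eq0 => /eqP ->.
      by rewrite conjc0 !mul0r !addr0.
    split; first by ring.
    rewrite mulrN [conjc b * b]mulrC mulc_conj -rmorphM -hab -normrX ger0_norm ?sqr_ge0 //.
    by rewrite expr2 addNr.
  pose z i := if i == u then zu else if i == v then zv else xu i * zu + xv i * zv.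
  have zuE : z u = zu by rewrite /z eqxx.
  have zvE : z v = zv by rewrite /z eqxx eq_sym (negbTE (gs_uv gs)).
  have zQ l : Q l -> z l = xu l * z u + xv l * z v.
    by rewrite zuE zvE /z => /andP[/negbTE -> /negbTE ->].
  exists z.
    have [b0|b0] := boolP (b == 0); last by exists u; rewrite zuE /zu (negbTE b0) oppr_eq0.
    by exists u; rewrite zuE /zu b0 oner_eq0.
  move=> i; rewrite rowE //.
  have [Qi|] := boolP (Q i).
    have e1 := hu i Qi; have e2 := hv i Qi; rewrite !reduced_systemE // in e1 e2.
    have -> : \sum_(j | Q j) A i j * xu j = lam%:C * xu i - A i u by rewrite -e1; ring.
    have -> : \sum_(j | Q j) A i j * xv j = lam%:C * xv i - A i v by rewrite -e2; ring.
    rewrite (zQ i Qi); ring.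
  rewrite negb_and !negbK => /orP[] /eqP ->; rewrite ?huu ?huv ?hvu ?hvv zuE zvE.
  + by apply/eqP; rewrite -subr_eq0; apply/eqP; rewrite -[RHS]hz1.1 rmorphB /=; ring.
  + by apply/eqP; rewrite -subr_eq0; apply/eqP; rewrite -[RHS]hz1.2 rmorphB /=; ring.
Qed.


Lemma Q_involution i : Q (s i) = Q i.
Proof.
have sv : s v = u by rewrite -(gs_su gs) (gs_sK gs).
have -> : (s i == u) = (i == v) by rewrite -sv (inj_eq (inv_inj (gs_sK gs))).
have -> : (s i == v) = (i == u) by rewrite -(gs_su gs) (inj_eq (inv_inj (gs_sK gs))).
by rewrite andbC.
Qed.

Lemma V_offdiag i j : i != j -> V i j = A i j.
Proof. by move=> /negbTE ->; rewrite mulr0n subr0. Qed.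

Lemma corrector_bound (lam : R) e x : e \in [:: u; v] -> win lam ->
  corrector lam e x -> \sum_(i | Q i) normc (x i) / w i e <= 4 * S * rho.
Proof.
move=> he hlam [hx _]; apply: reduced_bound hlam (gs_rho gs) hx _ => i Qi.
rewrite normc_opp -V_offdiag ?(gs_V gs) //.
by move: he; rewrite !inE => /orP[] /eqP ->; case/andP: Qi.
Qed.

(** Coupling back to the pair brings [w e1 l], which combines with the [w l e] of the weighted norm
    into [w e1 e]. This is how the off-diagonal correction inherits the factor [w u v]. *)
Lemma pairing_bound e1 e x : e1 \in [:: u; v] ->
  normc (\sum_(l | Q l) A e1 l * x l) <=
  rho * w e1 e * \sum_(l | Q l) normc (x l) / w l e.
Proof.
move=> he; apply: le_trans (normc_sum _ _ _) _; rewrite mulr_sumr ler_sum // => l Ql.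
have ne : e1 != l.
  by move: he; rewrite !inE => /orP[] /eqP ->; rewrite eq_sym; case/andP: Ql.
have wl := gs_w0 gs l e.
rewrite normcM [leRHS]mulrCA [leLHS]mulrC ler_wpM2l ?normc_ge0 // -V_offdiag //.
rewrite ler_pdivlMr //; apply: le_trans (_ : rho * w e1 l * w l e <= _).
  by rewrite ler_wpM2r ?(ltW wl) ?(gs_V gs).
by rewrite -mulrA ler_wpM2l ?(gs_rho gs) ?(gs_wM gs).
Qed.

(** Resolvent identity: the difference of the correctors solves the system at [lam] with source
    [(lam - lam') x'], where [x'] is itself bounded by [4 S rho]. *)
Lemma corrector_lipschitz (lam lam' : R) e x x' : e \in [:: u; v] ->
  win lam -> win lam' -> corrector lam e x -> corrector lam' e x' ->
  \sum_(i | Q i) normc (x i - x' i) / w i e <= 16 * S ^+ 2 * rho * `|lam - lam'|.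
Proof.
move=> he hl hl' hx hx'; have bd := corrector_bound he hl' hx'.
have phi0 : 0 <= `|lam - lam'| * (4 * S * rho).
  by rewrite mulr_ge0 // mulr_ge0 ?(gs_rho gs) // mulr_ge0 // ltW // (gs_S gs).
have hs : reduced_system lam (fun i => x i - x' i) (fun i => (lam - lam')%:C * x' i).
  move=> i Qi; rewrite reduced_systemE //.
  rewrite (eq_bigr (fun l => A i l * x l - A i l * x' l)); last by move=> l _; ring.
  rewrite sumrB; have := hx'.1 i Qi; have := hx.1 i Qi; rewrite !reduced_systemE // => e1 e2.
  have -> : \sum_(j | Q j) A i j * x j = lam%:C * x i - A i e by rewrite -e1; ring.
  have -> : \sum_(j | Q j) A i j * x' j = lam'%:C * x' i - A i e by rewrite -e2; ring.
  by rewrite rmorphB /=; ring.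
apply: le_trans (reduced_bound hl phi0 hs _) _ => [i Qi|]; last first.
  by rewrite le_eqVlt; apply/orP; left; apply/eqP; ring.
rewrite normcM normc_real -[leRHS]mulrA ler_wpM2l // -ler_pdivrMr ?(gs_w0 gs) //.
apply: le_trans bd; rewrite (bigD1 i) //= lerDl sumr_ge0 // => j _.
by rewrite divr_ge0 ?normc_ge0 ?(ltW (gs_w0 gs _ _)).
Qed.

(** Conjugation combined with [s] preserves the reduced system and exchanges [u] and [v]; uniqueness
    then identifies the two correctors. *)
Lemma corrector_conj (lam : R) xu xv : win lam ->
  corrector lam u xu -> corrector lam v xv ->
  forall i, Q i -> xv i = conjc (xu (s i)).
Proof.
move=> hlam [hu _] [hv _].
apply: (@reduced_unique lam xv (fun i => conjc (xu (s i))) _ hlam hv) => i Qi.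
have Qsi : Q (s i) by rewrite Q_involution.
rewrite reduced_systemE //; have := hu _ Qsi; rewrite reduced_systemE // => h.
have -> : - A i v = conjc (- A (s i) u).
  by rewrite -(gs_sK gs u) (gs_su gs) (gs_sym gs) rmorphN /= conjcK.
rewrite -h conjcB conjcM conjc_real; congr (_ - _).
rewrite (reindex_inj (inv_inj (gs_sK gs))) conjc_sum /=.
apply: eq_big => [l|l Ql]; first exact: Q_involution.
by rewrite conjcM -(gs_sym gs) !(gs_sK gs).
Qed.

(* The u-diagonal entry of the Schur complement equals A u u - <x, (A_QQ - lam) x>
   up to conjugation, hence is real. *)
Lemma corrector_real (lam : R) xu : win lam -> corrector lam u xu ->
  conjc (A u u + \sum_(l | Q l) A u l * xu l) = A u u + \sum_(l | Q l) A u l * xu l.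
Proof.
move=> hlam [hu _]; rewrite conjcD -(gs_herm gs); congr (_ + _).
have rowE l : Q l -> A l u = lam%:C * xu l - \sum_(m | Q m) A l m * xu m.
  move=> Ql; have := hu l Ql; rewrite reduced_systemE // => h.
  by apply: oppr_inj; rewrite -h; ring.
have formE : \sum_(l | Q l) A u l * xu l =
    \sum_(l | Q l) lam%:C * (xu l * conjc (xu l))
    - \sum_(l | Q l) \sum_(m | Q m) xu l * (conjc (xu m) * A m l).
  rewrite -sumrB; apply: eq_bigr => l Ql.
  rewrite (gs_herm gs l u) (rowE l Ql) conjcB conjcM conjc_real.
  rewrite mulrBl; congr (_ - _); first by ring.
  rewrite conjc_sum mulr_suml; apply: eq_bigr => m Qm.
  by rewrite conjcM (gs_herm gs l m); ring.
rewrite formE conjcB !conjc_sum; congr (_ - _).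
  by apply: eq_bigr => l _; rewrite !conjcM conjc_real conjcK; ring.
rewrite exchange_big /=; apply: eq_bigr => l Ql; rewrite conjc_sum.
apply: eq_bigr => m Qm.
by rewrite !conjcM conjcK -(gs_herm gs); ring.
Qed.

(** [al] and [be] are the diagonal and off-diagonal Schur entries. Their Lipschitz constant
    [16 (rho S) ^ 2] is at most [1 / 4], so the implicit equation [|al lam - lam| = normc (be lam)]
    is nearly explicit. *)
Lemma feshbach_reduction : exists (al : R -> R) (be : R -> R[i]),
  [/\ forall lam, win lam ->
        (\det (A - lam%:C%:M) == 0) = (`|al lam - lam| == normc (be lam)),
      forall lam, win lam -> `|al lam - d| <= 2 * rho,
      forall lam, win lam -> normc (be lam - A u v) <= 4 * (rho ^+ 2 * S) * w u v,
      forall lam lam', win lam -> win lam' ->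
        `|al lam - al lam'| <= 16 * (rho * S) ^+ 2 * `|lam - lam'| &
      forall lam lam', win lam -> win lam' ->
        normc (be lam - be lam') <= 16 * (rho * S) ^+ 2 * `|lam - lam'|].
Proof.
have ex e : exists X : R -> 'I_n -> R[i], forall lam, win lam -> corrector lam e (X lam).
  suff /choice[X hX] : forall lam, exists x, win lam -> corrector lam e x by exists X.
  move=> lam; have [hlam|] := pselect (win lam); last by exists (fun _ => 0).
  have [x hx] := reduced_exists (fun i => - A i e) hlam.
  by exists x.
have [Xu hXu] := ex u; have [Xv hXv] := ex v.
pose al lam := complex.Re (A u u + \sum_(l | Q l) A u l * Xu lam l).
pose be lam := A u v + \sum_(l | Q l) A u l * Xv lam l.
have alE lam : win lam -> A u u + \sum_(l | Q l) A u l * Xu lam l = (al lam)%:C.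
  by move=> hlam; apply: conjc_fixed; apply: corrector_real (hXu _ hlam).
have hu : u \in [:: u; v] by rewrite inE eqxx.
have hv : v \in [:: u; v] by rewrite !inE eqxx orbT.
have sv : s v = u by rewrite -(gs_su gs) (gs_sK gs).
have S0 := gs_S gs; have r0 := gs_rho gs; have small := gs_small gs.
have w0 := gs_w0 gs u v; have w1 := gs_w1 gs u v.
exists al, be; split.
- move=> lam hlam; have cj := corrector_conj hlam (hXu _ hlam) (hXv _ hlam).
  apply: feshbach_det (hXu _ hlam) (hXv _ hlam) _ _ _ _ => //; first exact: alE.
  + rewrite conjcD -(gs_herm gs); congr (_ + _).
    rewrite conjc_sum (reindex_inj (inv_inj (gs_sK gs))) /=.
    apply: eq_big => [l|l Ql]; first exact: Q_involution.
    rewrite conjcM -(gs_sym gs) (gs_su gs) cj ?conjcK //.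
    by rewrite -Q_involution.
  + rewrite -alE // -(corrector_real hlam (hXu _ hlam)).
    rewrite conjcD -(gs_sym gs) (gs_su gs); congr (_ + _).
    rewrite conjc_sum (reindex_inj (inv_inj (gs_sK gs))) /=.
    apply: eq_big => [l|l Ql]; first exact: Q_involution.
    rewrite conjcM -(gs_sym gs) (gs_su gs) cj ?(gs_sK gs) //.
- move=> lam hlam.
  have := corrector_bound hu hlam (hXu _ hlam).
  have := @pairing_bound u u (Xu lam) hu; rewrite (gs_wii gs) => h1 h2.
  have : normc ((al lam)%:C - d%:C) <= rho + rho * (4 * S * rho).
    rewrite -alE // addrAC; apply: le_trans (normcD_le _ _) _; apply: lerD.
      by have := gs_V gs u u; rewrite eqxx mulr1n (gs_Du gs) (gs_wii gs) mulr1.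
    by apply: le_trans h1 _; rewrite mulr1 ler_wpM2l.
  rewrite -rmorphB normc_real => h; apply: le_trans h _.
  by nra.
- move=> lam hlam; rewrite /be addrC addKr.
  apply: le_trans (pairing_bound v _ hu) _.
  have := corrector_bound hv hlam (hXv _ hlam) => h.
  apply: le_trans (_ : rho * w u v * (4 * S * rho) <= _).
    by rewrite ler_wpM2l // mulr_ge0 // ltW.
  by rewrite le_eqVlt; apply/orP; left; apply/eqP; ring.
- move=> lam lam' hl hl'.
  have := corrector_lipschitz hu hl hl' (hXu _ hl) (hXu _ hl') => h.
  rewrite -normc_real real_complexB -!alE // opprD addrACA subrr add0r -sumrB.
  under eq_bigr do rewrite -mulrBr.
  apply: le_trans (pairing_bound u _ hu) _; rewrite (gs_wii gs) mulr1.
  apply: le_trans (ler_wpM2l r0 h) _.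
  by rewrite le_eqVlt; apply/orP; left; apply/eqP; ring.
- move=> lam lam' hl hl'.
  have := corrector_lipschitz hv hl hl' (hXv _ hl) (hXv _ hl') => h.
  rewrite /be opprD addrACA subrr add0r -sumrB.
  under eq_bigr do rewrite -mulrBr.
  apply: le_trans (pairing_bound v _ hu) _.
  have X0 : 0 <= 16 * S ^+ 2 * rho * `|lam - lam'|.
    by rewrite mulr_ge0 // mulr_ge0 // mulr_ge0 // sqr_ge0.
  have rw0 : 0 <= rho * w u v by rewrite mulr_ge0 // ltW.
  apply: le_trans (ler_wpM2l rw0 h) _.
  apply: le_trans (_ : rho * 1 * (16 * S ^+ 2 * rho * `|lam - lam'|) <= _).
    by rewrite ler_wpM2r // ler_wpM2l.
  by rewrite le_eqVlt; apply/orP; left; apply/eqP; ring.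
Qed.

End Feshbach.

(** * Comparison of spectral gaps *)

Section GapComparison.
Context {R : realType}.

(** [f] is controlled on [[a, b]] only, so the intermediate value theorem is applied to [f] composed
    with the clamp onto [[a, b]], which is continuous on the whole line. *)
Lemma lipschitz_root (f : R -> R) (K a b : R) : a <= b -> 0 <= K ->
  (forall x y, a <= x <= b -> a <= y <= b -> `|f x - f y| <= K * `|x - y|) ->
  f a <= 0 -> 0 <= f b -> exists2 c, a <= c <= b & f c = 0.
Proof.
move=> ab K0 hf fa fb.
pose cl x := Num.max a (Num.min x b).
have cl_in x : a <= cl x <= b.
  by rewrite /cl le_max lexx /= ge_max ab ge_min lexx orbT.
have cl_id x : a <= x <= b -> cl x = x.
  by move=> /andP[ax xb]; rewrite /cl min_l // max_r.
have cl_lip x y : `|cl x - cl y| <= `|x - y|.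
  have h1 := ler_norm (x - y); have h2 : y - x <= `|x - y| by rewrite distrC ler_norm.
  rewrite ler_norml /cl /Order.max /Order.min.
  move: `|x - y| h1 h2 => m h1 h2; clear -h1 h2 ab.
  by case: (ltP x b) => ?; case: (ltP y b) => ?; do 2 case: ltP => ?;
    apply/andP; split; lra.
have g_cont : continuous (f \o cl).
  move=> x; apply/cvgrPdist_le => eps eps0 /=; near=> y.
  apply: le_trans (hf _ _ (cl_in x) (cl_in y)) _.
  apply: le_trans (ler_wpM2l K0 (cl_lip x y)) _.
  apply: le_trans (_ : (K + 1) * `|x - y| <= _).
    by rewrite ler_wpM2r // lerDl.
  rewrite -ler_pdivlMl ?ltr_wpDl //.
  near: y; apply: cvgr_dist_le; first exact: cvg_id.
  by rewrite mulr_gt0 // invr_gt0 ltr_wpDl.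
have [||c cab fc] := @IVT R (f \o cl) a b 0 ab.
- exact: continuous_subspaceT.
- by rewrite /= !cl_id ?lexx ?ab // ge_min fa le_max fb orbT.
have cab' : a <= c <= b by move: cab; rewrite in_itv.
by exists c => //; rewrite -fc /= cl_id.
Unshelve. all: by end_near. Qed.


Section WindowGap.
Context {n : nat}.
Variables (A : 'M[R[i]]_n) (D : 'I_n -> R) (d S rho : R).
Variables (w : 'I_n -> 'I_n -> R) (u v : 'I_n) (s : 'I_n -> 'I_n).
Hypothesis gs : gap_setting A D d S rho w u v s.

Local Notation win lam := (`|lam - d| <= (2 * S)^-1).
Local Notation eig lam := (\det (A - lam%:C%:M) == 0).

(** Eigenvalues in the window solve [lam = al lam +- normc (be lam)]. The variation of [al] across a
    gap has to be bounded by [rho ^ 2 S w u v], not merely by [rho ^ 2 S], or the decay would be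
    lost. *)
Lemma window_gap :
  (forall lam lam', win lam -> win lam' -> eig lam -> eig lam' ->
     `|lam - lam'| <= 2 * normc (A u v) + 16 * (rho ^+ 2 * S * w u v)) /\
  exists lam lam', [/\ win lam, win lam', eig lam, eig lam' &
     2 * normc (A u v) - 16 * (rho ^+ 2 * S * w u v) <= `|lam - lam'|].
Proof.
have [al [be [detE al_near be_near al_lip be_lip]]] := feshbach_reduction gs.
have S0 := gs_S gs; have r0 := gs_rho gs; have small := gs_small gs.
have W0 := gs_w0 gs u v; have W1 := gs_w1 gs u v.
have hB : normc (A u v) <= rho * w u v.
  by rewrite -(V_offdiag A D (gs_uv gs)) (gs_V gs).
have B0 := normc_ge0 (A u v).
set B := normc (A u v) in hB B0 *; set W := w u v in be_near W0 W1 hB *.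
set t := rho ^+ 2 * S * W.
have t0 : 0 <= t by rewrite /t mulr_ge0 ?(ltW W0) // mulr_ge0 ?sqr_ge0 // ltW.
have t8 : 8 * t <= rho * W.
  have -> : 8 * t = 8 * (rho * S) * (rho * W) by rewrite /t; ring.
  by rewrite ler_piMl // mulr_ge0 // ltW.
set e := 16 * (rho * S) ^+ 2 in al_lip be_lip.
have e0 : 0 <= e by rewrite mulr_ge0 // sqr_ge0.
have rS0 : 0 <= rho * S by rewrite mulr_ge0 // ltW.
have e4 : e <= 4^-1 by rewrite /e; nra.
have eW : e * (4 * (rho * W)) <= 8 * t.
  have -> : e * (4 * (rho * W)) = 8 * (rho * S) * (8 * t) by rewrite /e /t; ring.
  by rewrite ler_piMl // mulr_ge0.
have be_bd lam : win lam -> `|normc (be lam) - B| <= 4 * t.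
  move=> hl; apply: le_trans (normc_dist _ _) _; apply: le_trans (be_near _ hl) _.
  by rewrite /t le_eqVlt; apply/orP; left; apply/eqP; ring.
have rhoW : rho * W <= rho by rewrite ler_piMr.
have upper lam lam' : win lam -> win lam' -> eig lam -> eig lam' ->
    `|lam - lam'| <= 2 * B + 8 * t + e * `|lam - lam'|.
  move=> hl hl'; rewrite !detE // => /eqP h /eqP h'.
  have h1 : `|lam - al lam| = normc (be lam) by rewrite distrC.
  have h2 := al_lip _ _ hl hl'; have h3 := be_bd _ hl; have h4 := be_bd _ hl'.
  have h5 : `|lam - lam'| <= `|lam - al lam| + `|al lam - al lam'| + `|al lam' - lam'|.
    have -> : lam - lam' = (lam - al lam) + (al lam - al lam') + (al lam' - lam') by ring.
    by rewrite (le_trans (ler_normD _ _)) // lerD2r ler_normD.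
  move: h5 h3 h4; rewrite h1 h' !ler_norml => h5 /andP[_ h3] /andP[_ h4]; lra.
(* By [upper] and [e <= 1 / 4], three quarters of the gap are at most [2 B + 8 t <= 3 rho W]. So the
   gap is at most [4 rho W], and [e] times it is comparable with [t]. *)
have upper4 lam lam' : win lam -> win lam' -> eig lam -> eig lam' ->
    e * `|lam - lam'| <= 8 * t.
  move=> hl hl' h h'; apply: le_trans eW; rewrite ler_wpM2l //.
  have := upper _ _ hl hl' h h'; have : e * `|lam - lam'| <= 4^-1 * `|lam - lam'|.
    by rewrite ler_wpM2r.
  lra.
split=> [lam lam' hl hl' h h'|].
  have := upper _ _ hl hl' h h'; have := upper4 _ _ hl hl' h h'; lra.
(* One root for each sign: [al +- normc be] stays within [4 rho <= 1 / (2 S)] of [d], so [f] changes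
   sign across the window. *)
have root_ex (b : bool) : exists2 lam, win lam & lam - al lam = (-1) ^+ b * normc (be lam).
  pose f x := x - al x - (-1) ^+ b * normc (be x).
  have h0 : 0 < (2 * S)^-1 by rewrite invr_gt0 mulr_gt0.
  have win_in x : d - (2 * S)^-1 <= x <= d + (2 * S)^-1 -> win x.
    by rewrite ler_norml => /andP[? ?]; apply/andP; split; lra.
  have h4 : 4 * rho <= (2 * S)^-1.
    rewrite -[leRHS]mul1r ler_pdivlMr ?mulr_gt0 //; lra.
  have fbd x : win x -> `|al x + (-1) ^+ b * normc (be x) - d| <= 4 * rho.
    move=> hx; have := al_near _ hx; have := be_bd _ hx; have := normc_ge0 (be x).
    by rewrite !ler_norml; case: b @f => f /=; rewrite ?expr1 ?expr0; lra.
  have ab : d - (2 * S)^-1 <= d + (2 * S)^-1 by lra.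
  have [|x y hx hy|||c hc fc] := @lipschitz_root f (1 + 2 * e) _ _ ab.
  - lra.
  - have hx' := win_in _ hx; have hy' := win_in _ hy.
    have -> : f x - f y = (x - y) - (al x - al y) -
        (-1) ^+ b * (normc (be x) - normc (be y)) by rewrite /f; ring.
    apply: le_trans (ler_normB _ _) _; rewrite normrM normrX normrN1 expr1n mul1r.
    have := ler_normB (x - y) (al x - al y); have := al_lip _ _ hx' hy'.
    have := le_trans (normc_dist _ _) (be_lip _ _ hx' hy'); lra.
  - have /fbd := win_in _ (introT andP (conj (lexx _) ab)).
    by rewrite ler_norml /f => /andP[h1 h2]; lra.
  - have /fbd := win_in _ (introT andP (conj ab (lexx _))).
    by rewrite ler_norml /f => /andP[h1 h2]; lra.
  by exists c; [exact: win_in|apply/eqP; rewrite -subr_eq0; apply/eqP].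
have [l1 hl1 e1] := root_ex false; have [l2 hl2 e2] := root_ex true.
have d1 : eig l1.
  by rewrite detE // distrC e1 expr0 mul1r ger0_norm ?normc_ge0.
have d2 : eig l2.
  by rewrite detE // distrC e2 expr1 mulN1r normrN ger0_norm ?normc_ge0.
exists l1, l2; split=> //.
have := upper4 _ _ hl1 hl2 d1 d2; have := al_lip _ _ hl1 hl2.
have := be_bd _ hl1; have := be_bd _ hl2; have := ler_norm (l1 - l2).
move: e1 e2; rewrite expr0 expr1 mul1r mulN1r !ler_norml; lra.
Qed.

End WindowGap.

(** The lower estimate for [A'] provides two eigenvalues, shared with [A], whose distance the upper
    estimate for [A] limits; both matrices have the same window because [d] and [S] are common. *)
Lemma gap_comparison n (A A' : 'M[R[i]]_n) D d S rho w u v s :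
  gap_setting A D d S rho w u v s -> gap_setting A' D d S rho w u v s ->
  (forall lam : R, \det (A - lam%:C%:M) = \det (A' - lam%:C%:M)) ->
  normc (A' u v) <= normc (A u v) + 16 * (rho ^+ 2 * S * w u v).
Proof.
move=> gs gs' hdet.
have [up _] := window_gap gs.
have [_ [l [l' [hl hl' e e' low]]]] := window_gap gs'.
rewrite -!hdet in e e'.
have := up _ _ hl hl' e e'; lra.
Qed.

End GapComparison.

(** * Isospectrality *)

Section Isospectral.
Context {R : realType}.

Lemma is_derive_ext (f g : R -> R) (t l : R) : f =1 g ->
  is_derive t 1 f l -> is_derive t 1 g l.
Proof. by move=> /funext ->. Qed.

Lemma is_derive_bigsum (I : Type) (r : seq I) (P : pred I) (f : I -> R -> R) (f' : I -> R) (t : R) :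
  (forall i, P i -> is_derive t 1 (f i) (f' i)) ->
  is_derive t 1 (fun s => \sum_(i <- r | P i) f i s) (\sum_(i <- r | P i) f' i).
Proof.
move=> hf; elim: r => [|i r IH].
  rewrite big_nil; apply: is_derive_ext (is_derive_cst 0 t 1) => s.
  by rewrite big_nil.
rewrite big_cons; have [Pi|nPi] := boolP (P i).
  apply: is_derive_ext (is_deriveD (hf i Pi) IH) => s.
  by rewrite big_cons Pi.
by apply: is_derive_ext IH => s; rewrite big_cons (negbTE nPi).
Qed.

Lemma is_derive_bigprod (I : eqType) (r : seq I) (f : I -> R -> R) (f' : I -> R) (t : R) :
  uniq r -> (forall i, is_derive t 1 (f i) (f' i)) ->
  is_derive t 1 (fun s => \prod_(i <- r) f i s)
    (\sum_(i <- r) f' i * \prod_(j <- r | j != i) f j t).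
Proof.
move=> + hf; elim: r => [_|i r IH /= /andP[ir ur]].
  rewrite big_nil; apply: is_derive_ext (is_derive_cst (1 : R) t 1) => s.
  by rewrite big_nil.
have := is_deriveM (hf i) (IH ur).
set l := (X in is_derive _ _ _ X -> _) => h.
have -> : \sum_(k <- i :: r) f' k * \prod_(j <- i :: r | j != k) f j t = l.
  rewrite /l big_cons big_cons eqxx /= addrC; congr (_ + _).
    rewrite scaler_sumr big_seq [RHS]big_seq; apply: eq_bigr => k kr.
    rewrite big_cons; case: eqVneq => [eki|_]; first by rewrite eki kr in ir.
    by rewrite /= mulrCA.
  rewrite mulrC /=; congr (_ * _); rewrite big_seq_cond [RHS]big_seq.
  apply: eq_bigl => k; case kr: (k \in r) => //=.
  by apply/eqP => eki; rewrite -eki kr in ir.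
by apply: is_derive_ext h => s; rewrite big_cons.
Qed.

(** Jacobi's formula, obtained from the Leibniz expansion by the product rule. *)
Lemma is_derive_det n (M : R -> 'M[R]_n) (M' : 'M[R]_n) (t : R) :
  (forall i j, is_derive t 1 (fun s => M s i j) (M' i j)) ->
  is_derive t 1 (fun s => \det (M s)) (\tr (M' *m \adj (M t))).
Proof.
move=> hM.
(* [M t] with row [i] replaced by its derivative; the determinant, expanded along that row, is the
   [i]-th diagonal entry of [M' *m \adj (M t)]. *)
pose N i : 'M[R]_n := \matrix_(k, l) (if k == i then M' k l else M t k l).
have -> : \tr (M' *m \adj (M t)) = \sum_i \det (N i).
  apply: eq_bigr => i _; rewrite mxE (expand_det_row _ i).
  apply: eq_bigr => j _; rewrite !mxE eqxx; congr (_ * _).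
  rewrite /cofactor; congr (_ * \det _); apply/matrixP => k l.
  by rewrite !mxE eq_sym (negbTE (neq_lift _ _)).
rewrite exchange_big /=.
apply: is_derive_bigsum => s _.
rewrite -mulr_sumr.
have hp := @is_derive_bigprod 'I_n (index_enum 'I_n) (fun i s0 => M s0 i (s i))
  (fun i => M' i (s i)) t (index_enum_uniq _) (fun i => hM i (s i)).
apply: (is_derive_eq (is_deriveZ ((-1) ^+ s) hp)).
congr (_ * _); apply: eq_bigr => i _.
rewrite [RHS](bigD1 i) //= mxE eqxx; congr (_ * _).
by apply: eq_bigr => j /negbTE ji; rewrite mxE ji.
Qed.

(** The derivative is the trace of [[B, L - lam]] times the adjugate of [L - lam]. It vanishes by
    cyclicity, a matrix commuting with its adjugate; the flow generated by [B] is never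
    integrated. *)
Lemma lax_det_const n (L B : R -> 'M[R]_n) :
  (forall (t : R) i j, is_derive t 1 (fun s => L s i j) ((B t *m L t - L t *m B t) i j)) ->
  forall (lam t : R), \det (L t - lam%:M) = \det (L 0 - lam%:M).
Proof.
move=> hL lam t; apply: (@is_derive_0_is_cst _ (fun t => \det (L t - lam%:M))) => {}t.
have hM i j : is_derive t 1 (fun s => (L s - lam%:M) i j) ((B t *m L t - L t *m B t) i j).
  have := is_deriveB (hL t i j) (is_derive_cst ((lam%:M : 'M[R]_n) i j) t 1).
  rewrite subr0; apply: is_derive_ext => s.
  by rewrite !mxE.
apply: (is_derive_eq (is_derive_det hM)).
have -> : B t *m L t - L t *m B t = B t *m (L t - lam%:M) - (L t - lam%:M) *m B t.
  rewrite mulmxBr mulmxBl mul_mx_scalar mul_scalar_mx opprB addrA subrK //.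
rewrite mulmxBl linearB /= -mulmxA mul_mx_adj [X in _ - X]mxtrace_mulC mulmxA.
by rewrite mul_adj_mx mul_mx_scalar mul_scalar_mx subrr.
Qed.

End Isospectral.

(** * Hamilton's equations of the Toda lattice in Lax form *)

Section TodaLax.
Context {R : realType} {N : nat}.

Lemma derive_along_line (f : 'rV[R]_N -> R) (a v : 'rV[R]_N) (l : R) :
  is_derive (0 : R) 1 (fun h : R => f (h *: v + a)) l -> 'D_v f a = l.
Proof.
move=> [_ <-]; rewrite /derive.
suff -> : (fun h => h^-1 *: ((f \o shift a) (h *: v) - f a)) =
    (fun h => h^-1 *: (((fun h => f (h *: v + a)) \o shift 0) (h *: 1) - f (0 *: v + a))).
  by [].
by apply/funext => h /=; rewrite addr0 scale0r add0r [h *: 1]mulr1.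
Qed.

Lemma is_derive_affine (c b t : R) : is_derive t 1 (fun s => s * c + b) c.
Proof.
have := is_deriveD (is_deriveZ c (is_derive_id t 1)) (is_derive_cst b t 1).
rewrite addr0 [_ *: 1]mulr1; apply: is_derive_ext => s.
by rewrite mulrC.
Qed.

Lemma toda_dp (p q : 'rV[R]_N) j :
  'D_(delta_mx 0 j) (fun y => toda_hamiltonian y q) p = p 0 j.
Proof.
apply: derive_along_line.
have h i : is_derive (0 : R) 1
    (fun h : R => 2^-1 * (h * (i == j)%:R + p 0 i) ^+ 2) ((i == j)%:R * p 0 i).
  have := is_deriveZ 2^-1 (is_deriveX 2 (is_derive_affine (i == j)%:R (p 0 i) 0)).
  rewrite mul0r add0r expr1 => h; apply: (is_derive_eq h).
  by rewrite /GRing.scale /=; field.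
have := is_deriveD (is_derive_bigsum (P := xpredT) (index_enum 'I_N) (fun i _ => h i))
  (is_derive_cst (\sum_(i < N) expR (q 0 i - q 0 (ordS i))) (0 : R) 1).
have -> : \sum_(i < N) (i == j)%:R * p 0 i = p 0 j.
  by rewrite (bigD1 j) //= eqxx mul1r big1 ?addr0 // => i /negbTE ->; rewrite mul0r.
rewrite addr0.
apply: is_derive_ext => h'; rewrite /toda_hamiltonian; congr (_ + _).
rewrite mulr_sumr; apply: eq_bigr => i _; rewrite !mxE eqxx /=.
by [].
Qed.

Lemma toda_dq (p q : 'rV[R]_N) j :
  'D_(delta_mx 0 j) (fun x => toda_hamiltonian p x) q =
  expR (q 0 j - q 0 (ordS j)) - expR (q 0 (ord_pred j) - q 0 j).
Proof.
apply: derive_along_line.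
pose c i : R := (i == j)%:R - (ordS i == j)%:R.
have h i : is_derive (0 : R) 1
    (fun h : R => expR (h * c i + (q 0 i - q 0 (ordS i))))
    (c i * expR (q 0 i - q 0 (ordS i))).
  have := is_derive1_comp (is_derive_expR _) (is_derive_affine (c i) (q 0 i - q 0 (ordS i)) 0).
  by rewrite mul0r add0r mulrC.
have := is_deriveD (is_derive_cst (2^-1 * \sum_(i < N) p 0 i ^+ 2) (0 : R) 1)
  (is_derive_bigsum (P := xpredT) (index_enum 'I_N) (fun i _ => h i)).
rewrite add0r /c.
have -> : \sum_(i < N) ((i == j)%:R - (ordS i == j)%:R) * expR (q 0 i - q 0 (ordS i)) =
    expR (q 0 j - q 0 (ordS j)) - expR (q 0 (ord_pred j) - q 0 j).
  rewrite (eq_bigr (fun i => (i == j)%:R * expR (q 0 i - q 0 (ordS i)) -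
    (i == ord_pred j)%:R * expR (q 0 i - q 0 (ordS i)))); last first.
    by move=> i _; rewrite mulrBl -(inj_eq (@ordS_inj N) i (ord_pred j)) ord_predK.
  rewrite sumrB; congr (_ - _).
    by rewrite (bigD1 j) //= eqxx mul1r big1 ?addr0 // => i /negbTE ->; rewrite mul0r.
  rewrite (bigD1 (ord_pred j)) //= eqxx mul1r big1 ?addr0 ?ord_predK // => i /negbTE ->.
  by rewrite mul0r.
apply: is_derive_ext => h'; rewrite /toda_hamiltonian; congr (_ + _).
apply: eq_bigr => i _; rewrite !mxE eqxx /=; congr expR; rewrite /c; ring.
Qed.

Variables (p q : R -> 'rV[R]_N).
Hypothesis sol : hamilton_solution (@toda_hamiltonian R N) p q.

Lemma toda_q' (t : R) j : is_derive t 1 (fun s => q s 0 j) (p t 0 j).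
Proof. by have [+ _] := sol t j; rewrite toda_dp. Qed.

Lemma toda_p' (t : R) j : is_derive t 1 (fun s => p s 0 j)
  (expR (q t 0 (ord_pred j) - q t 0 j) - expR (q t 0 j - q t 0 (ordS j))).
Proof. by have [_ +] := sol t j; rewrite toda_dq opprB. Qed.

Lemma toda_momentum t : \sum_j p t 0 j = \sum_j p 0 0 j.
Proof.
apply: (@is_derive_0_is_cst _ (fun t => \sum_j p t 0 j)) => {}t.
have := is_derive_bigsum (P := xpredT) (index_enum 'I_N) (fun j _ => toda_p' t j).
rewrite sumrB (reindex_inj (@ordS_inj N)) /=.
by under eq_bigr do rewrite ordSK; rewrite subrr.
Qed.

Variable m : nat.

(* The sign on the corner entry selects the periodic (m even) or the antiperiodic
   (m odd) Jacobi matrix; for N = 2 both hops land on the same entry and add up. *)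
Definition toda_hop (t : R) : 'M[R]_N := \matrix_(i, j)
  if j == ordS i then (-1) ^+ (m * (i.+1 == N)) * expR ((q t 0 i - q t 0 j) / 2) else 0.
Local Notation X := toda_hop.
Local Notation P t := (diag_mx (p t)).

(** Flaschka's Jacobi matrix without the customary factor [1 / 2], so that the lattice at rest has
    eigenvalues [2 cos (twist)]. *)
Definition toda_lax t := X t + (X t)^T - P t.

Lemma X_derive (t : R) i j :
  is_derive t 1 (fun s => X s i j) ((2^-1 *: (P t *m X t - X t *m P t)) i j).
Proof.
have -> : (2^-1 *: (P t *m X t - X t *m P t)) i j = X t i j * ((p t 0 i - p t 0 j) * 2^-1).
  by rewrite mul_diag_mx mul_mx_diag !mxE; case: ifP => _; ring.
case hj : (j == ordS i); last first.
  rewrite mxE hj mul0r; apply: is_derive_ext (is_derive_cst (0 : R) t 1) => s.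
  by rewrite mxE hj.
have h1 : is_derive t 1 (fun s => (q s 0 i - q s 0 j) / 2) ((p t 0 i - p t 0 j) * 2^-1).
  have := is_deriveZ 2^-1 (is_deriveB (toda_q' t i) (toda_q' t j)).
  rewrite [_ *: (_ - _)]mulrC; apply: is_derive_ext => s.
  by rewrite mulrC.
have h2 := is_deriveZ ((-1) ^+ (m * (i.+1 == N))) (is_derive1_comp (is_derive_expR _) h1).
rewrite mxE hj -mulrA; apply: is_derive_ext h2 => s.
by rewrite mxE hj.
Qed.

(** [X] has one entry in each row and column, so its products with the transpose are diagonal; the
    corner sign squares to [1]. *)
Lemma X_XT t : X t *m (X t)^T = diag_mx (\row_j expR (q t 0 j - q t 0 (ordS j))).
Proof.
apply/matrixP => i j; rewrite mxE (bigD1 (ordS i)) //= big1 ?addr0; last first.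
  by move=> k /negbTE nk; rewrite mxE nk mul0r.
rewrite !mxE eqxx (inj_eq (@ordS_inj N)).
case: (eqVneq i j) => [->|_]; last by rewrite mulr0 mulr0n.
rewrite mulrACA -exprMn mulrNN mulr1 expr1n mul1r -expRD mulr1n; congr expR.
by field.
Qed.

Lemma XT_X t : (X t)^T *m X t = diag_mx (\row_j expR (q t 0 (ord_pred j) - q t 0 j)).
Proof.
apply/matrixP => i j; rewrite mxE (bigD1 (ord_pred i)) //= big1 ?addr0; last first.
  move=> k nk; rewrite mxE [X t k i]mxE; case: eqP => [ik|]; last by rewrite mul0r.
  by rewrite ik ordSK eqxx in nk.
rewrite !mxE ord_predK eqxx eq_sym.
case: (eqVneq i j) => [->|_]; last by rewrite mulr0 mulr0n.
rewrite mulrACA -exprMn mulrNN mulr1 expr1n mul1r -expRD mulr1n; congr expR.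
by field.
Qed.

(** [[B, X + X^T] = X X^T - X^T X] is a difference of bond forces, that is, minus the derivative of
    [P]; and [- [B, P]] is the derivative of [X + X^T]. *)
Lemma toda_lax_pair (t : R) i j :
  let B := 2^-1 *: (X t - (X t)^T) in
  is_derive t 1 (fun s => toda_lax s i j) ((B *m toda_lax t - toda_lax t *m B) i j).
Proof.
move=> B.
have hP : is_derive t 1 (fun s => P s i j) (((X t)^T *m X t - X t *m (X t)^T) i j).
  rewrite XT_X X_XT !mxE; case: (eqVneq i j) => [->|nij]; last first.
    rewrite !mulr0n subr0; apply: is_derive_ext (is_derive_cst (0 : R) t 1) => s.
    by rewrite mxE (negbTE nij).
  rewrite !mulr1n; apply: is_derive_ext (toda_p' t j) => s.
  by rewrite mxE eqxx.
have -> : B *m toda_lax t - toda_lax t *m B =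
    2^-1 *: (P t *m X t - X t *m P t) + (2^-1 *: (P t *m X t - X t *m P t))^T
    - ((X t)^T *m X t - X t *m (X t)^T).
  have -> : (2^-1 *: (P t *m X t - X t *m P t))^T =
      2^-1 *: ((X t)^T *m P t - P t *m (X t)^T).
    by rewrite [LHS]linearZ /= [(_ - _)^T]linearB /= !trmx_mul tr_diag_mx.
  rewrite /toda_lax /B; move: (X t) (X t)^T (P t) => Y Z W.
  rewrite -scalemxAl -scalemxAr -scalerBr.
  rewrite !(mulmxBl, mulmxBr, mulmxDl, mulmxDr).
  by apply/matrixP => k l; rewrite !mxE; field.
have entE (U V : 'M[R]_N) : (U + U^T - V) i j = U i j + U j i - V i j by rewrite !mxE.
rewrite entE.
apply: is_derive_ext (is_deriveB (is_deriveD (X_derive t i j) (X_derive t j i)) hP) => s.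
by rewrite /toda_lax entE.
Qed.

Lemma toda_lax_det t (lam : R) :
  \det (toda_lax t - lam%:M) = \det (toda_lax 0 - lam%:M).
Proof.
exact: (@lax_det_const _ _ toda_lax (fun t => 2^-1 *: (X t - (X t)^T)) toda_lax_pair).
Qed.

End TodaLax.

(** * Fourier and Bloch bases *)

Section Cis.
Context {R : realType}.
Implicit Types (x y : R).

Lemma cisD x y : cis (x + y) = cis x * cis y.
Proof. by rewrite /cis cosD sinD; congr Complex; ring. Qed.

Lemma cis0 : cis (0 : R) = 1.
Proof. by rewrite /cis cos0 sin0. Qed.

Lemma conjc_cis x : conjc (cis x) = cis (- x).
Proof. by rewrite /cis /= cosN sinN. Qed.

Lemma normc_cis x : normc (cis x) = 1.
Proof. by rewrite /cis /= cos2Dsin2 sqrtr1. Qed.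

Lemma cis_neq0 x : cis x != 0.
Proof.
apply/eqP => h; have := normc_cis x.
by rewrite h ComplexField.Normc.normc0 => /eqP; rewrite eq_sym oner_eq0.
Qed.

Lemma cisN_mul x : cis (- x) * cis x = 1.
Proof. by rewrite -cisD addNr cis0. Qed.

Lemma cis_expn x k : cis (x * k%:R) = cis x ^+ k.
Proof.
elim: k => [|k IH]; first by rewrite mulr0 cis0 expr0.
by rewrite -natr1 mulrDr mulr1 cisD IH exprSr.
Qed.

Lemma cis_pi k : cis (pi * k%:R) = (-1) ^+ k :> R[i].
Proof.
rewrite cis_expn; congr (_ ^+ _); rewrite /cis cospi sinpi.
by congr Complex; rewrite oppr0.
Qed.

Lemma cis_2pi k : cis (2 * pi * k%:R) = 1 :> R[i].
Proof. by rewrite mulrAC mulrC -natrM cis_pi exprM sqrrN expr1n expr1n. Qed.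

Lemma cisDcisN x : cis x + cis (- x) = (2 * cos x)%:C.
Proof. by rewrite /cis cosN sinN; congr Complex; ring. Qed.

Lemma cosB_prod x y : cos x - cos y = - 2 * sin ((x + y) / 2) * sin ((x - y) / 2).
Proof.
have h u v : - 2 * sin u * sin v = cos (u + v) - cos (u - v) :> R.
  by rewrite cosB cosD; ring.
by rewrite h; congr (cos _ - cos _); field.
Qed.

(* Mean value theorem on [0, x] and on [x, pi / 2], the cosine being decreasing. *)
Lemma jordan_sin x : 0 <= x <= pi / 2 -> 2 / pi * x <= sin x.
Proof.
move=> /andP[]; have pi0 := @pi_gt0 R.
rewrite le_eqVlt => /orP[/eqP <- _|x0]; first by rewrite sin0 mulr0.
rewrite le_eqVlt => /orP[/eqP ->|xpi].
  have pn : pi != 0 :> R by rewrite gt_eqF // pi_gt0.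
  have -> : 2 / pi * (pi / 2) = 1 :> R by rewrite mulrA divfK // divff ?pnatr_eq0.
  by rewrite sin_pihalf.
have mvt (a b : R) : a < b -> exists2 c, a < c < b & sin b - sin a = cos c * (b - a).
  move=> ab; have [|c cab ->] := @MVT R sin cos a b ab (fun z _ => is_derive_sin z).
    exact/continuous_subspaceT/continuous_sin.
  by exists c => //; move: cab; rewrite in_itv.
have [c1 /andP[h1 h1'] e1] := mvt _ _ x0; have [c2 /andP[h2 h2'] e2] := mvt _ _ xpi.
rewrite sin0 !subr0 in e1; rewrite sin_pihalf in e2.
have hc : cos c2 <= cos c1.
  rewrite ltW // ltr_cos ?in_itv /=; [lra|lra|lra].
have h : x * (1 - sin x) <= sin x * (pi / 2 - x).
  rewrite e2 e1 [leRHS]mulrAC mulrCA [leRHS]mulrAC -mulrA.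
  rewrite ler_wpM2r // mulr_ge0 //; lra.
rewrite mulrAC ler_pdivrMr //; lra.
Qed.

End Cis.

(** * Multiplication operators in the discrete Fourier basis *)

Section FourierMatrix.
Context {R : realType} {n : nat}.
Local Notation N := n.+1.
Implicit Types (f g : 'I_N -> R).

Lemma sum_cis (i j : 'I_N) :
  \sum_(l < N) cis (2 * pi * l%:R * (i%:R - j%:R) / N%:R) = (N%:R *+ (i == j))%:C :> R[i].
Proof.
have N0 : (N%:R : R) != 0 by rewrite pnatr_eq0.
case: (eqVneq i j) => [->|nij].
  rewrite mulr1n (eq_bigr (fun _ => 1)) ?sumr_const ?card_ord; last first.
    by move=> l _; rewrite subrr mulr0 mul0r cis0.
  by rewrite -[LHS](rmorph_nat (real_complex R)).
pose z : R[i] := cis (2 * pi * (i%:R - j%:R) / N%:R).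
have -> : \sum_(l < N) cis (2 * pi * l%:R * (i%:R - j%:R) / N%:R) = \sum_(l < N) z ^+ l.
  apply: eq_bigr => l _; rewrite -cis_expn; congr cis; ring.
have zN : z ^+ N = 1.
  rewrite -cis_expn divfK // mulrBr cisD -mulrN.
  rewrite cis_2pi mul1r mulrN -conjc_cis cis_2pi; exact: conjc1.
(* [z = 1] would force [sin (pi (i - j) / N) = 0], impossible for [0 < |i - j| < N]. *)
have z1 : z != 1.
  apply/eqP => z1.
  have : sin (pi * (i%:R - j%:R) / N%:R) = 0 :> R.
    have h : cos (pi * (i%:R - j%:R) / N%:R *+ 2) = 1 :> R.
      have := congr1 (@complex.Re R) z1; rewrite /= => h; rewrite -[RHS]h; congr cos.
      by rewrite -mulr_natr; ring.
    have := cos2Dsin2 (pi * (i%:R - j%:R) / N%:R : R); move: h; rewrite cos_mulr2n mulr2n.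
    move: (cos _) (sin _) => c s h h2.
    by apply/eqP; rewrite -sqrf_eq0; apply/eqP; lra.
  have pos (a b : 'I_N) : (a < b)%N -> 0 < sin (pi * (b%:R - a%:R) / N%:R) :> R.
    move=> ab; apply: sin_gt0_pi; apply/andP; split.
      by rewrite divr_gt0 // mulr_gt0 ?pi_gt0 // subr_gt0 ltr_nat.
    rewrite ltr_pdivrMr // ltr_pM2l ?pi_gt0 // ltrBlDr -natrD ltr_nat.
    by rewrite ltn_addr.
  move=> s0; case: (ltngtP i j) => [ij|ji|/val_inj eij].
  - have := pos _ _ ij; have -> : pi * (j%:R - i%:R) / N%:R =
      - (pi * (i%:R - j%:R) / N%:R) :> R by ring.
    by rewrite sinN s0 oppr0 ltxx.
  - by have := pos _ _ ji; rewrite s0 ltxx.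
  - by rewrite eij eqxx in nij.
have := subrXX 1 z N; rewrite expr1n zN subrr.
under eq_bigr do rewrite expr1n mul1r.
move/esym/eqP; rewrite mulf_eq0 subr_eq0 eq_sym (negbTE z1) /= => /eqP h.
rewrite mulr0n /= -[RHS]h; exact: eq_bigr.
Qed.

(* Multiplication by [f], written in the Fourier basis. *)
Definition fourier_mx f : 'M[R[i]]_N :=
  \matrix_(i, j) ((N%:R^-1)%:C *
    \sum_(l < N) (f l)%:C * cis (2 * pi * l%:R * (j%:R - i%:R) / N%:R)).

Lemma fourier_mx_herm f i j : fourier_mx f j i = conjc (fourier_mx f i j).
Proof.
rewrite !mxE conjcM conjc_real conjc_sum; congr (_ * _); apply: eq_bigr => l _.
by rewrite conjcM conjc_real conjc_cis; congr (_ * cis _); ring.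
Qed.

Lemma fourier_mxD f g i j :
  fourier_mx (fun l => f l + g l) i j = fourier_mx f i j + fourier_mx g i j.
Proof.
rewrite !mxE -mulrDr -big_split /=; congr (_ * _); apply: eq_bigr => l _.
by rewrite real_complexD mulrDl.
Qed.

Lemma fourier_mxZ (c : R) f i j :
  fourier_mx (fun l => c * f l) i j = c%:C * fourier_mx f i j.
Proof.
rewrite !mxE mulrCA; congr (_ * _); rewrite mulr_sumr; apply: eq_bigr => l _.
by rewrite real_complexM mulrA.
Qed.

Lemma fourier_mx1 : fourier_mx (fun _ => 1) = 1%:M.
Proof.
apply/matrixP => i j; rewrite !mxE.
under eq_bigr do rewrite mul1r.
rewrite sum_cis eq_sym; case: (i == j); last by rewrite !mulr0n mulr0.
rewrite !mulr1n -real_complexM mulVf ?pnatr_eq0 //.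
Qed.

(** Quasi-momentum of the Bloch wave [i]. The waves gain the sign [(-1) ^ k] over one period, and
    the shift by [k / 2] gives the indices [0] and [k] opposite quasi-momenta, hence equal free
    eigenvalues. *)
Definition twist (k : nat) (i : 'I_N) : R := pi * (2 * i%:R - k%:R) / N%:R.

(** At a fixed site [l] the values of the waves form a left eigenvector of [fourier_mx f] with
    eigenvalue [f l]. Any twist will do, since the entries depend only on index differences. *)
Lemma twist_sum (k : nat) f (l j : 'I_N) :
  \sum_(i < N) cis (twist k i * l%:R) * fourier_mx f i j = (f l)%:C * cis (twist k j * l%:R).
Proof.
have -> : \sum_(i < N) cis (twist k i * l%:R) * fourier_mx f i j =
  (N%:R^-1)%:C * \sum_(m < N) (f m)%:C * cis (2 * pi * m%:R * j%:R / N%:R - pi * k%:R * l%:R / N%:R) *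
    \sum_(i < N) cis (2 * pi * i%:R * (l%:R - m%:R) / N%:R).
  rewrite mulr_sumr.
  transitivity (\sum_(i < N) \sum_(m < N) (N%:R^-1)%:C * ((f m)%:C *
     cis (2 * pi * m%:R * j%:R / N%:R - pi * k%:R * l%:R / N%:R) *
     cis (2 * pi * i%:R * (l%:R - m%:R) / N%:R))).
    apply: eq_bigr => i _; rewrite mxE mulr_sumr mulr_sumr; apply: eq_bigr => m _.
    rewrite mulrCA; congr (_ * _); rewrite mulrCA -[RHS]mulrA; congr (_ * _).
    by rewrite -!cisD; congr cis; rewrite /twist; ring.
  rewrite exchange_big /=; apply: eq_bigr => m _.
  by rewrite -!mulr_sumr.
rewrite (bigD1 l) //= sum_cis eqxx mulr1n big1 ?addr0; last first.
  by move=> m /negbTE ml; rewrite sum_cis eq_sym ml mulr0n mulr0.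
rewrite mulrCA -real_complexM mulVf ?pnatr_eq0 // mulr1; congr (_ * cis _).
by rewrite /twist; ring.
Qed.

Lemma fourier_mxM f g : fourier_mx (fun l => f l * g l) = fourier_mx f *m fourier_mx g.
Proof.
(* Fourier inversion: a matrix is determined by its products with the waves. *)
have W0 (l : 'I_N) (B C : 'M[R[i]]_N) :
    (forall l j : 'I_N, \sum_(i < N) cis (twist 0 i * l%:R) * B i j =
       \sum_(i < N) cis (twist 0 i * l%:R) * C i j) ->
    B = C.
  move=> h; apply/matrixP => i j.
  have key (M : 'M[R[i]]_N) : (N%:R)%:C * M i j =
      \sum_(l < N) cis (- (twist 0 i * l%:R)) * \sum_(m < N) cis (twist 0 m * l%:R) * M m j.
    transitivity (\sum_(m < N) \sum_(l < N) cis (2 * pi * l%:R * (m%:R - i%:R) / N%:R) * M m j).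
      under eq_bigr do rewrite -mulr_suml sum_cis.
      rewrite (bigD1 i) //= eqxx mulr1n big1 ?addr0 // => m /negbTE ->.
      by rewrite mulr0n mul0r.
    rewrite exchange_big /=; apply: eq_bigr => a _; rewrite mulr_sumr.
    apply: eq_bigr => m _; rewrite mulrA -cisD; congr (cis _ * _).
    by rewrite /twist; ring.
  have N0 : ((N%:R : R)%:C : R[i]) != 0.
    by apply/eqP => /(congr1 (@complex.Re R)) /= /eqP; rewrite pnatr_eq0.
  by apply: (mulfI N0); rewrite !key; apply: eq_bigr => a _; rewrite h.
apply: (W0 ord0) => l j; rewrite twist_sum.
under [RHS]eq_bigr do rewrite mxE mulr_sumr.
rewrite exchange_big /=.
under [RHS]eq_bigr do (under eq_bigr do rewrite mulrA; rewrite -mulr_suml twist_sum -mulrA).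
by rewrite -mulr_sumr twist_sum real_complexM mulrA.
Qed.

End FourierMatrix.

(** * The Lax matrix in a Bloch basis *)

Section BlochMatrix.
Context {R : realType} {n : nat}.
Local Notation N := n.+1.

(* The Lax matrix in the basis of the Bloch waves [wave k]. *)
Definition bloch_mx (k : nat) (p q : 'rV[R]_N) : 'M[R[i]]_N :=
  \matrix_(i, j) (fourier_mx (fun l => - p 0 l) i j +
    fourier_mx (fun l => expR ((q 0 l - q 0 (ordS l)) / 2)) i j *
    (cis (twist k j) + cis (- twist k i))).

Let wave (k : nat) : 'M[R[i]]_N := \matrix_(l, j) cis (twist k j * l%:R).

Lemma wave_det k : \det (wave k) != 0.
Proof.
apply/eqP => h.
pose Wc : 'M[R[i]]_N := \matrix_(i, l) cis (- (twist k i * l%:R)).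
have : Wc *m wave k = ((N%:R : R)%:C)%:M.
  apply/matrixP => i j; rewrite !mxE.
  transitivity (\sum_(l < N) cis (2 * pi * l%:R * (j%:R - i%:R) / N%:R) : R[i]).
    by apply: eq_bigr => l _; rewrite !mxE -cisD; congr cis; rewrite /twist; ring.
  by rewrite sum_cis eq_sym; case: (i == j).
move/(congr1 (@determinant _ _)); rewrite det_mulmx h mulr0 det_scalar => /esym/eqP.
rewrite expf_eq0 /= => /eqP /(congr1 (@complex.Re R)) /= /eqP.
by rewrite pnatr_eq0.
Qed.

(** The sign at the seam cancels the factor [(-1) ^ k] that a wave picks up over one period, so
    hopping acts as a pure phase. *)
Lemma wave_shift (k : nat) (l j : 'I_N) :
  (-1) ^+ (k * (l.+1 == N)) * cis (twist k j * (ordS l)%:R) =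
  cis (twist k j * l%:R) * cis (twist k j) :> R[i].
Proof.
have -> : cis (twist k j * l%:R) * cis (twist k j) = cis (twist k j * l.+1%:R) :> R[i].
  by rewrite -cisD -natr1; congr cis; ring.
case: eqP => [eN|/eqP nN] /=.
- have -> : (l.+1 %% N)%N = 0%N by rewrite eN modnn.
  rewrite mulr0 cis0 mulr1 muln1 eN /twist divfK ?pnatr_eq0 //.
  rewrite mulrBr cisD mulrA [pi * 2]mulrC cis_2pi mul1r -conjc_cis cis_pi.
  rewrite -signr_odd; case: (odd k); rewrite ?expr0 ?expr1 ?conjc1 //=.
  by congr Complex; rewrite !oppr0.
- rewrite muln0 expr0 mul1r modn_small //.
  by rewrite ltn_neqAle nN ltn_ord.
Qed.

Lemma wave_unshift (k : nat) (l j : 'I_N) :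
  cis (twist k j * l%:R) * cis (- twist k j) =
  (-1) ^+ (k * ((ord_pred l).+1 == N)) * cis (twist k j * (ord_pred l)%:R) :> R[i].
Proof.
have := wave_shift k (ord_pred l) j; rewrite ord_predK => h.
apply: (mulIf (cis_neq0 (twist k j))).
rewrite -mulrA cisN_mul mulr1 -[RHS]mulrA -h mulrA -exprD addnn -mul2n exprM.
by rewrite sqrrN expr1n expr1n mul1r.
Qed.

Lemma bloch_intertwine (k : nat) (p q : R -> 'rV[R]_N) t :
  map_mx (real_complex R) (toda_lax p q k t) *m wave k =
  wave k *m bloch_mx k (p t) (q t).
Proof.
apply/matrixP => l j; rewrite mxE.
pose a l := expR ((q t 0 l - q t 0 (ordS l)) / 2).
pose sg (l : 'I_N) : R := (-1) ^+ (k * (l.+1 == N)).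
transitivity ((sg l * a l)%:C * cis (twist k j * (ordS l)%:R) +
    (sg (ord_pred l) * a (ord_pred l))%:C * cis (twist k j * (ord_pred l)%:R) -
    (p t 0 l)%:C * cis (twist k j * l%:R)).
  transitivity (\sum_i (toda_hop q k t l i)%:C * cis (twist k j * i%:R) +
     \sum_i (toda_hop q k t i l)%:C * cis (twist k j * i%:R) -
     \sum_i (diag_mx (p t) l i)%:C * cis (twist k j * i%:R)).
    rewrite -big_split -sumrB /=; apply: eq_bigr => i _.
    rewrite [X in X * _ = _]mxE [wave _ _ _]mxE -mulrDl -mulrBl; congr (_ * _).
    have -> : toda_lax p q k t l i = toda_hop q k t l i + toda_hop q k t i l - diag_mx (p t) l i.
      have entE (U V : 'M[R]_N) : (U + U^T - V) l i = U l i + U i l - V l i by rewrite !mxE.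
      exact: entE.
    by rewrite real_complexB real_complexD.
  congr (_ + _ - _).
  - rewrite (bigD1 (ordS l)) //= big1 ?addr0; last first.
      by move=> i /negbTE ni; rewrite mxE ni mul0r.
    by rewrite mxE eqxx.
  - rewrite (bigD1 (ord_pred l)) //= big1 ?addr0; last first.
      move=> i ni; rewrite mxE; case: eqP => [e|]; last by rewrite mul0r.
      by rewrite e ordSK eqxx in ni.
    by rewrite mxE ord_predK eqxx /a ord_predK.
  - rewrite (bigD1 l) //= big1 ?addr0; last first.
      by move=> i ni; rewrite mxE eq_sym (negbTE ni) mulr0n mul0r.
    by rewrite mxE eqxx mulr1n.
have sgC m : (sg m)%:C = (-1) ^+ (k * (m.+1 == N)) :> R[i].
  by rewrite /sg (rmorphXn (real_complex R)) (rmorphN (real_complex R)) rmorph1.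
transitivity ((- p t 0 l)%:C * cis (twist k j * l%:R) +
    (a l)%:C * cis (twist k j * l%:R) * cis (twist k j) +
    (sg (ord_pred l))%:C * ((a (ord_pred l))%:C * cis (twist k j * (ord_pred l)%:R))).
  rewrite -[in RHS]mulrA -wave_shift !real_complexM !sgC (rmorphN (real_complex R)) /=.
  by ring.
rewrite mxE -(twist_sum k (fun l => - p t 0 l) l j) -(twist_sum k a l j).
rewrite -(twist_sum k a (ord_pred l) j) mulr_suml mulr_sumr -!big_split /=; apply: eq_bigr => i _.
rewrite [bloch_mx _ _ _ _ _]mxE [wave _ _ _]mxE.
move: (fourier_mx _ i j) (fourier_mx a i j) => F G.
apply: esym; transitivity (cis (twist k i * l%:R) * F + cis (twist k i * l%:R) * G * cis (twist k j) +
    (cis (twist k i * l%:R) * cis (- twist k i)) * G); first by ring.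
by rewrite wave_unshift sgC; ring.
Qed.

Lemma bloch_det (k : nat) (p q : R -> 'rV[R]_N) t (lam : R) :
  \det (bloch_mx k (p t) (q t) - lam%:C%:M) = (\det (toda_lax p q k t - lam%:M))%:C.
Proof.
have h : map_mx (real_complex R) (toda_lax p q k t - lam%:M) *m wave k =
    wave k *m (bloch_mx k (p t) (q t) - lam%:C%:M).
  rewrite map_mxB map_scalar_mx mulmxBl bloch_intertwine mulmxBr.
  by rewrite mul_scalar_mx mul_mx_scalar.
have := congr1 (@determinant _ _) h; rewrite !det_mulmx mulrC => /(mulfI (wave_det k)) <-.
by rewrite det_map_mx.
Qed.

End BlochMatrix.

(** * Exponentially weighted Fourier coefficients *)

Section WeightedFourier.
Context {R : realType} {n : nat}.
Local Notation N := n.+1.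
Variable sigma : R.
Hypothesis sigma_ge0 : 0 <= sigma.
Implicit Types (f g : 'I_N -> R).

(** Distance on the ring [Z / N]; with truncated subtraction [(i - j) + (j - i)] is the absolute
    difference. *)
Definition cyc_dist (i j : 'I_N) : nat :=
  minn ((i - j) + (j - i))%N (N - ((i - j) + (j - i)))%N.

Definition weight (i j : 'I_N) : R := expR (- sigma * (cyc_dist i j)%:R).

Lemma cyc_dist_triangle i j k : (cyc_dist i k <= cyc_dist i j + cyc_dist j k)%N.
Proof.
rewrite /cyc_dist; have := ltn_ord i; have := ltn_ord j; have := ltn_ord k.
lia.
Qed.

Lemma cyc_distC i j : cyc_dist i j = cyc_dist j i.
Proof. by rewrite /cyc_dist addnC. Qed.

Lemma weight_gt0 i j : 0 < weight i j.
Proof. exact: expR_gt0. Qed.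

Lemma weight_le1 i j : weight i j <= 1.
Proof. by rewrite -expR0 ler_expR mulNr oppr_le0 mulr_ge0. Qed.

Lemma weight_refl i : weight i i = 1.
Proof. by rewrite /weight /cyc_dist subnn min0n mulr0 expR0. Qed.

Lemma weightM i j k : weight i j * weight j k <= weight i k.
Proof.
rewrite -expRD ler_expR -mulrDr !mulNr lerN2 ler_wpM2l // -natrD ler_nat.
exact: cyc_dist_triangle.
Qed.

Definition weighted_le (c : R) f : Prop :=
  forall i j, normc (fourier_mx f i j) <= c * weight i j.

Lemma weighted_leW c c' f : c <= c' -> weighted_le c f -> weighted_le c' f.
Proof. by move=> cc' hf i j; rewrite (le_trans (hf i j)) // ler_wpM2r // ltW // weight_gt0. Qed.

Lemma weighted_leD c c' f g : weighted_le c f -> weighted_le c' g ->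
  weighted_le (c + c') (fun l => f l + g l).
Proof.
move=> hf hg i j; rewrite fourier_mxD mulrDl.
by rewrite (le_trans (normcD_le _ _)) // lerD.
Qed.

Lemma weighted_leZ c a f : weighted_le c f -> weighted_le (`|a| * c) (fun l => a * f l).
Proof.
by move=> hf i j; rewrite fourier_mxZ normcM normc_real -mulrA ler_wpM2l.
Qed.

(** By [weightM] each of the [N] terms of the matrix product keeps the full weight. The price is a
    factor [N], affordable because [c] will be of order [N ^ -2]. *)
Lemma weighted_leM c c' f g : 0 <= c -> 0 <= c' ->
  weighted_le c f -> weighted_le c' g ->
  weighted_le (N%:R * (c * c')) (fun l => f l * g l).
Proof.
move=> c0 c'0 hf hg i j; rewrite fourier_mxM mxE.
apply: le_trans (normc_sum _ _ _) _.
apply: le_trans (_ : \sum_(k < N) c * c' * weight i j <= _); last first.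
  by rewrite sumr_const card_ord -[leLHS]mulr_natl !mulrA.
apply: ler_sum => k _; rewrite normcM.
apply: le_trans (ler_pM (normc_ge0 _) (normc_ge0 _) (hf i k) (hg k j)) _.
by rewrite mulrACA ler_wpM2l ?mulr_ge0 // weightM.
Qed.

Lemma fourier_mx_le f (e : R) i j : (forall l, `|f l| <= e) ->
  normc (fourier_mx f i j) <= e.
Proof.
move=> hf; rewrite mxE normcM normc_real ger0_norm ?invr_ge0 //.
rewrite mulrC ler_pdivrMr //; apply: le_trans (normc_sum _ _ _) _.
apply: le_trans (_ : \sum_(k < N) e <= _); last by rewrite sumr_const card_ord mulr_natr.
by apply: ler_sum => l _; rewrite normcM normc_cis mulr1 normc_real.
Qed.

Lemma weighted_leX c f k : 0 <= c -> weighted_le c f ->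
  weighted_le (c * (N%:R * c) ^+ k) (fun l => f l ^+ k.+1).
Proof.
move=> c0 hf; elim: k => [|k IH]; first by rewrite expr0 mulr1.
have h : 0 <= c * (N%:R * c) ^+ k by rewrite mulr_ge0 // exprn_ge0 // mulr_ge0.
have := weighted_leM c0 h hf IH.
have -> : N%:R * (c * (c * (N%:R * c) ^+ k)) = c * (N%:R * c) ^+ k.+1 by rewrite exprS; ring.
by move=> h2 i j; have := h2 i j; congr (normc (fourier_mx _ i j) <= _).
Qed.

Lemma fact_ge_pow2 k : (2 ^ k.+1 <= k.+2`!)%N.
Proof.
elim: k => [|k IH] //; rewrite factS expnS leq_mul //.
Qed.

(** Each power of [f] is bounded by [weighted_leX]. As [(k + 2)! >= 2 ^ (k + 1)] and [N c <= 1], a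
    geometric series with sum [N c ^ 2] dominates. *)
Lemma weighted_le_exp c f : 0 <= c -> N%:R * c <= 1 -> weighted_le c f ->
  weighted_le (N%:R * c ^+ 2) (fun l => expR (f l) - 1 - f l).
Proof.
move=> c0 Nc hf i j.
have part M : weighted_le (N%:R * c ^+ 2 * (1 - 2^-1 ^+ M))
    (fun l => \sum_(k < M) f l ^+ k.+2 / (k.+2`!)%:R).
  elim: M => [|M IH].
    move=> a b; rewrite expr0 subrr mulr0 mul0r.
    by apply: fourier_mx_le => l; rewrite big_ord0 normr0.
  have h1 := weighted_leZ ((M.+2`!)%:R^-1) (weighted_leX M.+1 c0 hf).
  have h2 : `|(M.+2`!)%:R^-1| * (c * (N%:R * c) ^+ M.+1) <= N%:R * c ^+ 2 * 2^-1 ^+ M.+1.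
    rewrite ger0_norm ?invr_ge0 // exprS.
    have -> : (M.+2`!)%:R^-1 * (c * (N%:R * c * (N%:R * c) ^+ M)) =
      N%:R * c ^+ 2 * ((M.+2`!)%:R^-1 * (N%:R * c) ^+ M) by ring.
    rewrite ler_wpM2l ?mulr_ge0 ?sqr_ge0 //.
    apply: le_trans (_ : (M.+2`!)%:R^-1 * 1 <= _).
      by rewrite ler_wpM2l ?invr_ge0 // exprn_ile1 // mulr_ge0.
    rewrite mulr1 exprVn lef_pV2 ?posrE ?exprn_gt0 ?ltr0n ?fact_gt0 //.
    by rewrite -natrX ler_nat fact_ge_pow2.
  have := weighted_leD IH (weighted_leW h2 h1).
  have -> : N%:R * c ^+ 2 * (1 - 2^-1 ^+ M) + N%:R * c ^+ 2 * 2^-1 ^+ M.+1 =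
      N%:R * c ^+ 2 * (1 - 2^-1 ^+ M.+1).
    by rewrite [2^-1 ^+ M.+1]exprS; move: (2^-1 ^+ M) => z; field.
  move=> h3 a b; have := h3 a b; congr (normc (fourier_mx _ a b) <= _).
  by apply/funext => l; rewrite big_ord_recr /= [X in _ + X]mulrC.
(* Passage to the limit at a fixed entry: the tail is small uniformly in [l], and since [e] is
   arbitrary the unweighted bound [fourier_mx_le] suffices for it. *)
apply/ler_addgt0Pr => e e0.
have hcv l : (series (exp_coeff (f l)) @ \oo --> expR (f l))%classic.
  exact: is_cvg_series_exp_coeff.
have hnear : (\forall m \near \oo, forall l : 'I_N,
    `|expR (f l) - series (exp_coeff (f l)) m| <= e)%classic.
  by apply: filter_forall => l; apply: cvgr_dist_le e0; exact: hcv.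
have [m [m2 hM]] := filter_ex (filterI (nbhs_infty_ge 2) hnear).
case: m m2 hM => [|[|M]] // _ hM.
have -> : fourier_mx (fun l => expR (f l) - 1 - f l) i j =
    fourier_mx (fun l => \sum_(k < M) f l ^+ k.+2 / (k.+2`!)%:R) i j +
    fourier_mx (fun l => expR (f l) - series (exp_coeff (f l)) M.+2) i j.
  rewrite -fourier_mxD; congr (fourier_mx _ i j); apply/funext => l.
  rewrite /series /= big_mkord !big_ord_recl /exp_coeff /= expr0 expr1 fact0.
  by rewrite !divr1; ring.
apply: le_trans (normcD_le _ _) _. apply: lerD; last exact: fourier_mx_le.
apply: le_trans (part M i j) _.
by rewrite ler_wpM2r ?(ltW (weight_gt0 _ _)) // ler_piMr ?mulr_ge0 ?sqr_ge0.
Qed.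

End WeightedFourier.

(** * Spectral gaps of the Lax matrix *)

Section BlochGap.
Context {R : realType} {n : nat}.
Local Notation N := n.+1.

Lemma sum_inv_sqr m : \sum_(y < m) ((y.+1)%:R : R) ^- 2 <= 2.
Proof.
case: m => [|m]; first by rewrite big_ord0.
(* The sharper bound [2 - 1 / (m + 1)] is the one that telescopes under induction. *)
suff : \sum_(y < m.+1) ((y.+1)%:R : R) ^- 2 <= 2 - (m.+1)%:R^-1.
  by move/le_trans; apply; rewrite gerBl invr_ge0.
elim: m => [|m IH]; first by rewrite big_ord1 expr1n invr1; lra.
rewrite big_ord_recr /=; apply: le_trans (lerD IH (lexx _)) _.
have a0 : 0 < (m.+1)%:R :> R by rewrite ltr0n.
have -> : (m.+2)%:R = (m.+1)%:R + 1 :> R by rewrite -natr1.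
move: (m.+1)%:R a0 => a a0.
have b0 : 0 < a + 1 by lra.
have h : (a + 1) ^- 2 <= a^-1 - (a + 1)^-1.
  have -> : a^-1 - (a + 1)^-1 = (a * (a + 1))^-1 by field; rewrite !gt_eqF.
  by rewrite lef_pV2 ?posrE ?exprn_gt0 ?mulr_gt0 // expr2 ler_pM2r //; lra.
lra.
Qed.

(** Each distance is [x] or [N - x], so its inverse square is at most the sum of both inverse
    squares, and each of the two sums is at most [2]. *)
Lemma sum_cyc_dist (j : 'I_N) :
  \sum_(i | i != j) ((cyc_dist i j)%:R : R) ^- 2 <= 4.
Proof.
rewrite (reindex_inj (addrI j)) /=.
have nz (x : 'I_N) : (j + x != j) = (x != 0) by rewrite -subr_eq0 addrC addKr.
under eq_bigl do rewrite nz.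
have dE (x : 'I_N) : cyc_dist (j + x) j = minn x (N - x).
  have hx := ltn_ord x; have hj := ltn_ord j.
  have -> : cyc_dist (j + x) j = minn (((j + x) %% N - j) + (j - (j + x) %% N))%N
     (N - (((j + x) %% N - j) + (j - (j + x) %% N)))%N by [].
  case: (ltnP (j + x) N) => h; first by rewrite modn_small //; lia.
  have -> : ((j + x) %% N)%N = (j + x - N)%N.
    by rewrite -[in LHS](subnK h) modnDr modn_small //; lia.
  lia.
have s1 : \sum_(x : 'I_N | x != 0) ((x : nat)%:R : R) ^- 2 <= 2.
  rewrite big_mkcond big_ord_recl /= add0r.
  apply: le_trans (sum_inv_sqr n); rewrite le_eqVlt; apply/orP; left; apply/eqP.
  by apply: eq_bigr.
have s2 : \sum_(x : 'I_N | x != 0) ((N - x)%N%:R : R) ^- 2 <= 2.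
  apply: le_trans s1; rewrite [leRHS](reindex_inj oppr_inj) /=.
  rewrite le_eqVlt; apply/orP; left; apply/eqP.
  apply: eq_big => x; first by rewrite oppr_eq0.
  move=> x0; congr (_%:R ^- 2).
  have x1 : (0 < x)%N by rewrite lt0n.
  by rewrite /= modn_small // ltn_subrL x1.
apply: le_trans (_ : \sum_(x : 'I_N | x != 0)
    (((x : nat)%:R : R) ^- 2 + ((N - x)%N%:R : R) ^- 2) <= _); last first.
  rewrite big_split /=; lra.
apply: ler_sum => x x0; rewrite dE /minn.
by case: ifP => _; rewrite ?lerDl ?lerDr invr_ge0 exprn_ge0.
Qed.

Lemma sin_ge_dist (m : nat) : (m <= N)%N ->
  2 * (minn m (N - m))%:R / N%:R <= sin (pi * m%:R / N%:R) :> R.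
Proof.
move=> mN; have pi0 := @pi_gt0 R.
have main k : (2 * k <= N)%N -> 2 * k%:R / N%:R <= sin (pi * k%:R / N%:R) :> R.
  move=> kN; apply: le_trans (_ : 2 / pi * (pi * k%:R / N%:R) <= _).
    have -> : 2 / pi * (pi * k%:R / N%:R) = 2 * k%:R / N%:R * (pi / pi) :> R by ring.
    by rewrite divff ?mulr1 // gt_eqF.
  apply: jordan_sin; rewrite divr_ge0 ?mulr_ge0 ?pi_ge0 //=.
  rewrite ler_pdivrMr // -mulrA ler_pM2l // mulrC ler_pdivlMr // -natrM ler_nat.
  by rewrite mulnC.
case: (leqP (2 * m) N) => h; first by rewrite (_ : minn _ _ = m) ?main //; lia.
have -> : minn m (N - m) = (N - m)%N by lia.
have -> : pi * m%:R / N%:R = pi - pi * (N - m)%N%:R / N%:R :> R.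
  by rewrite natrB // mulrBr mulrBl mulfK ?pnatr_eq0 // opprB addrC subrK.
rewrite -[sin _]opprK -sinN opprB.
have -> : pi * (N - m)%N%:R / N%:R - pi = pi * (N - m)%N%:R / N%:R + - pi :> R by [].
rewrite sinB cospi sinpi mulr0 subr0 mulrN1 opprK main //; lia.
Qed.

Variable v : 'I_N.
Hypothesis v_neq0 : v != 0.

Definition bloch_diag (i : 'I_N) : R := 2 * cos (twist v i).

Lemma twist0 (k : nat) : twist k (0 : 'I_N) = - (pi * k%:R / N%:R) :> R.
Proof. by rewrite /twist /= mulr0 sub0r mulrN mulNr. Qed.

(** A difference of cosines is a product of two sines, one for the distance to each resonant index.
    Each is at least [2 / N] times that distance, and [4 * 2 * 2 = 16]. *)
Lemma bloch_diag_dist (i : 'I_N) :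
  16 / N%:R ^+ 2 * ((cyc_dist i 0)%:R * (cyc_dist i v)%:R) <=
  `|bloch_diag i - bloch_diag 0|.
Proof.
have -> : bloch_diag i - bloch_diag 0 = - 4 * (sin (pi * (i%:R - v%:R) / N%:R) * sin (pi * i%:R / N%:R)).
  rewrite /bloch_diag -mulrBr cosB_prod !mulrA; congr (_ * sin _ * sin _).
  - by ring.
  - by rewrite twist0 /twist; move: N%:R^-1 => M; field.
  - by rewrite twist0 /twist; move: N%:R^-1 => M; field.
have hi : 2 * (cyc_dist i 0)%:R / N%:R <= `|sin (pi * i%:R / N%:R)| :> R.
  apply: le_trans (ler_norm _); have -> : cyc_dist i 0 = minn i (N - i).
    by rewrite /cyc_dist /= subn0 sub0n addn0.
  by apply: sin_ge_dist; rewrite ltnW.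
have hv : 2 * (cyc_dist i v)%:R / N%:R <= `|sin (pi * (i%:R - v%:R) / N%:R)| :> R.
  have := ltn_ord i; have := ltn_ord v => lv li.
  case: (leqP v i) => h.
  - rewrite -natrB //; apply: le_trans (ler_norm _).
    have -> : cyc_dist i v = minn (i - v) (N - (i - v)) by rewrite /cyc_dist; lia.
    by apply: sin_ge_dist; lia.
  - have -> : pi * (i%:R - v%:R) / N%:R = - (pi * (v - i)%N%:R / N%:R) :> R.
      by rewrite natrB 1?ltnW //; ring.
    rewrite sinN normrN; apply: le_trans (ler_norm _).
    have -> : cyc_dist i v = minn (v - i) (N - (v - i)) by rewrite /cyc_dist; lia.
    by apply: sin_ge_dist; lia.
rewrite normrM normrM normrN normr_nat.
apply: le_trans (_ : 4 * (2 * (cyc_dist i v)%:R / N%:R * (2 * (cyc_dist i 0)%:R / N%:R)) <= _).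
  by rewrite le_eqVlt -exprVn; move: N%:R^-1 => M; apply/orP; left; apply/eqP; ring.
by rewrite ler_pM2l // ler_pM // divr_ge0 // mulr_ge0.
Qed.

Lemma cyc_dist_gt0 (i j : 'I_N) : i != j -> (0 < cyc_dist i j)%N.
Proof.
move=> ij; have hi := ltn_ord i; have hj := ltn_ord j.
have : (i : nat) != j by [].
rewrite /cyc_dist; lia.
Qed.

Lemma bloch_small_divisors :
  (forall i, (i != 0) && (i != v) -> bloch_diag i != bloch_diag 0) /\
  \sum_(i | (i != 0) && (i != v)) `|bloch_diag i - bloch_diag 0|^-1 <= N%:R ^+ 2 / 4.
Proof.
have N0 : 0 < N%:R :> R by rewrite ltr0n.
have low i : (i != 0) && (i != v) -> 0 < 16 / N%:R ^+ 2 * ((cyc_dist i 0)%:R * (cyc_dist i v)%:R) :> R.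
  by case/andP => i0 iv; rewrite mulr_gt0 ?divr_gt0 ?exprn_gt0 // mulr_gt0 // ltr0n cyc_dist_gt0.
split=> [i hi|].
  rewrite -subr_eq0 -normr_gt0; exact: lt_le_trans (low _ hi) (bloch_diag_dist i).
(* [1 / (a b) <= (a ^ -2 + b ^ -2) / 2] separates the two distances, whence [32 = 16 * 2]; the two
   sums of at most [4] then give [8 / 32 = 1 / 4]. *)
apply: le_trans (_ : \sum_(i | (i != 0) && (i != v)) N%:R ^+ 2 / 32 *
    ((cyc_dist i 0)%:R ^- 2 + (cyc_dist i v)%:R ^- 2) <= _).
  apply: ler_sum => i hi; have /andP[i0 iv] := hi.
  have a0 : 0 < (cyc_dist i 0)%:R :> R by rewrite ltr0n cyc_dist_gt0.
  have b0 : 0 < (cyc_dist i v)%:R :> R by rewrite ltr0n cyc_dist_gt0.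
  have h0 := low _ hi; have hd := bloch_diag_dist i.
  apply: le_trans (_ : (16 / N%:R ^+ 2 * ((cyc_dist i 0)%:R * (cyc_dist i v)%:R))^-1 <= _).
    by rewrite lef_pV2 ?posrE // (lt_le_trans h0 hd).
  move: (cyc_dist i 0)%:R (cyc_dist i v)%:R a0 b0 => a b a0 b0.
  have -> : (16 / N%:R ^+ 2 * (a * b))^-1 = N%:R ^+ 2 / 32 * (2 * (a^-1 * b^-1)).
    by clear -N0 a0 b0; move: (N%:R : R) N0 => M M0; field; rewrite !gt_eqF.
  rewrite ler_wpM2l ?divr_ge0 ?exprn_ge0 //.
  have := sqr_ge0 (a^-1 - b^-1); rewrite sqrrB !exprVn; lra.
rewrite -mulr_sumr big_split /=.
have h0 : \sum_(i | (i != 0) && (i != v)) ((cyc_dist i 0)%:R : R) ^- 2 <= 4.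
  apply: le_trans (sum_cyc_dist 0); rewrite [leRHS](bigID (fun i => i != v)) /= lerDl.
  by apply: sumr_ge0 => i _; rewrite invr_ge0 exprn_ge0.
have hv : \sum_(i | (i != 0) && (i != v)) ((cyc_dist i v)%:R : R) ^- 2 <= 4.
  apply: le_trans (sum_cyc_dist v); rewrite [leRHS](bigID (fun i => i != 0)) /=.
  under [in leRHS]eq_bigl do rewrite andbC.
  by rewrite lerDl; apply: sumr_ge0 => i _; rewrite invr_ge0 exprn_ge0.
apply: le_trans (_ : N%:R ^+ 2 / 32 * (4 + 4) <= _).
  by rewrite ler_wpM2l ?divr_ge0 ?exprn_ge0 // lerD.
by rewrite le_eqVlt; apply/orP; left; apply/eqP; field.
Qed.

End BlochGap.

(** * The Bloch matrix satisfies the hypotheses of the reduction *)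

Section BlochSetting.
Context {R : realType} {n : nat}.
Local Notation N := n.+1.
Variable v : 'I_N.

Lemma reflect_val (i : 'I_N) :
  ((v - i)%R : nat)%:R = v%:R - i%:R + N%:R * (v < i)%N%:R :> R.
Proof.
have -> : ((v - i)%R : nat) = ((v + (N - i) %% N) %% N)%N by [].
rewrite modnDmr; have hi := ltn_ord i; have hv := ltn_ord v.
case: (ltnP v i) => h.
- rewrite modn_small ?mulr1; last by lia.
  by rewrite addnBA 1?ltnW // natrB ?natrD; [ring|lia].
- have -> : (v + (N - i) = v - i + N)%N by lia.
  by rewrite modnDr modn_small ?natrB ?mulr0 ?addr0 //; lia.
Qed.

(** Reflection reverses the sign of [j - i], which is conjugation because [f] is real; wrapping
    around the ring changes the phase by multiples of [2 pi]. *)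
Lemma fourier_mx_reflect (f : 'I_N -> R) i j :
  fourier_mx f (v - i) (v - j) = conjc (fourier_mx f i j).
Proof.
rewrite -fourier_mx_herm !mxE; congr (_ * _); apply: eq_bigr => l _; congr (_ * _).
rewrite !reflect_val.
set bi : nat := (v < i)%N; set bj : nat := (v < j)%N.
have -> : 2 * pi * l%:R * (v%:R - j%:R + N%:R * bj%:R - (v%:R - i%:R + N%:R * bi%:R)) / N%:R =
  2 * pi * l%:R * (i%:R - j%:R) / N%:R + 2 * pi * (l * bj)%N%:R - 2 * pi * (l * bi)%N%:R :> R.
  have N0 : (N%:R : R) != 0 by rewrite pnatr_eq0.
  rewrite !natrM; move: (N%:R : R) N0 => M M0; field.
  exact: M0.
by rewrite cisD -conjc_cis cis_2pi conjc1 mulr1 cisD cis_2pi mulr1.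
Qed.

Lemma twist_reflect i : cis (twist v (v - i)) = cis (- twist v i) :> R[i].
Proof.
rewrite /twist reflect_val; set b : nat := (v < i)%N.
have -> : pi * (2 * (v%:R - i%:R + N%:R * b%:R) - v%:R) / N%:R =
   - (pi * (2 * i%:R - v%:R) / N%:R) + 2 * pi * b%:R :> R.
  have N0 : (N%:R : R) != 0 by rewrite pnatr_eq0.
  move: (N%:R : R) N0 => M M0; field; exact: M0.
by rewrite cisD cis_2pi mulr1.
Qed.

Variables (sigma c : R) (p q : 'rV[R]_N).
Hypothesis sigma_ge0 : 0 <= sigma.
Hypothesis v_neq0 : v != 0.
Hypothesis c_ge0 : 0 <= c.
Hypothesis c_small : 6 * c * N%:R ^+ 2 <= 1.

Let r (l : 'I_N) := q 0 l - q 0 (ordS l).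
Hypothesis p_le : weighted_le sigma c (fun l => p 0 l).
Hypothesis r_le : weighted_le sigma c r.

Let half l := 2^-1 * r l.
Let g l := expR (half l) - 1 - half l.

Lemma cN_small : 6 * (N%:R * c) <= 1.
Proof.
apply: le_trans c_small; rewrite -mulrA ler_pM2l // expr2 mulrA [c * _]mulrC.
by rewrite ler_peMr ?mulr_ge0 // ler1n.
Qed.

Lemma half_le : weighted_le sigma (2^-1 * c) half.
Proof.
have := weighted_leZ 2^-1 r_le; by rewrite ger0_norm ?invr_ge0.
Qed.

Lemma g_le : weighted_le sigma (N%:R * c ^+ 2 / 4) g.
Proof.
have -> : N%:R * c ^+ 2 / 4 = N%:R * (2^-1 * c) ^+ 2 by field.
apply: weighted_le_exp half_le => //; first by rewrite mulr_ge0 ?invr_ge0.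
have := cN_small; have : 0 <= N%:R * c by rewrite mulr_ge0.
lra.
Qed.

Lemma hop_expansion i j :
  fourier_mx (fun l => expR ((q 0 l - q 0 (ordS l)) / 2)) i j =
  (i == j)%:R + fourier_mx half i j + fourier_mx g i j.
Proof.
have -> : (i == j)%:R = fourier_mx (fun _ => 1 : R) i j by rewrite fourier_mx1 mxE.
rewrite -!fourier_mxD; congr (fourier_mx _ i j); apply/funext => l.
rewrite /g /half /r [2^-1 * _]mulrC; ring.
Qed.

(** The perturbation is at most [c + 2 (c / 2 + N c ^ 2 / 4) <= 3 c] times the weight, the factor
    [2] counting the two hop phases. With [S = N ^ 2 / 4], the condition [8 rho S <= 1] is exactly
    [c_small]. *)
Lemma bloch_gap_setting :
  gap_setting (bloch_mx v p q) (bloch_diag v) (bloch_diag v 0) (N%:R ^+ 2 / 4) (3 * c)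
    (weight sigma) 0 v (fun i => v - i).
Proof.
have N0 : 0 < N%:R :> R by rewrite ltr0n.
have [Dneq Dsum] := @bloch_small_divisors R _ _ v_neq0.
have diagE (k : 'I_N) : (bloch_diag v k)%:C = cis (twist v k) + cis (- twist v k) :> R[i].
  by rewrite cisDcisN.
split=> //.
- by rewrite mulr_ge0.
- have -> : 8 * (3 * c * (N%:R ^+ 2 / 4)) = 6 * c * N%:R ^+ 2 by field.
  exact: c_small.
- by rewrite eq_sym.
- apply: complexI; rewrite !diagE -twist_reflect subrr.
  by rewrite addrC; congr (_ + _); rewrite -twist_reflect subr0.
- by move=> i; rewrite subKr.
- by rewrite subr0.
- move=> i j; rewrite [LHS]mxE [in RHS]mxE conjcD conjcM conjcD !conjc_cis opprK.
  by rewrite -!fourier_mx_herm [cis (twist v i) + _]addrC.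
- move=> i j; rewrite [LHS]mxE [in RHS]mxE conjcD conjcM conjcD !conjc_cis opprK.
  rewrite !fourier_mx_reflect twist_reflect; congr (_ + _ * (_ + _)).
  by rewrite -!conjc_cis twist_reflect conjc_cis opprK.
- exact: weight_gt0.
- exact: weight_le1.
- exact: weight_refl.
- exact: weightM.
- move=> i j; rewrite mxE hop_expansion.
  have -> : fourier_mx (fun l => - p 0 l) i j +
      ((i == j)%:R + fourier_mx half i j + fourier_mx g i j) * (cis (twist v j) + cis (- twist v i)) -
      (bloch_diag v i *+ (i == j))%:C =
    - fourier_mx (fun l => p 0 l) i j +
      (fourier_mx half i j + fourier_mx g i j) * (cis (twist v j) + cis (- twist v i)).
    have -> : fourier_mx (fun l => - p 0 l) i j = - fourier_mx (fun l => p 0 l) i j.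
      have := fourier_mxZ (-1) (fun l => p 0 l) i j.
      rewrite (rmorphN (real_complex R)) rmorph1 mulN1r => <-.
      by congr (fourier_mx _ i j); apply/funext => l; rewrite mulN1r.
    case: (eqVneq i j) => [->|_]; last by rewrite !mulr0n; ring.
    by rewrite !mulr1n diagE; ring.
  apply: le_trans (normcD_le _ _) _; rewrite normc_opp normcM.
  apply: le_trans (_ : c * weight sigma i j +
     (2^-1 * c * weight sigma i j + N%:R * c ^+ 2 / 4 * weight sigma i j) * 2 <= _).
    apply: lerD; first exact: p_le.
    apply: ler_pM; rewrite ?normc_ge0 //.
      by apply: le_trans (normcD_le _ _) _; apply: lerD; [exact: half_le|exact: g_le].
    by apply: le_trans (normcD_le _ _) _; rewrite !normc_cis.
  have w0 := weight_gt0 sigma i j; move: (weight sigma i j) w0 => w w0.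
  have h1 : N%:R * c * (c * w) <= c * w.
    rewrite ler_piMl ?mulr_ge0 ?(ltW w0) //; have := cN_small.
    have : 0 <= N%:R * c by rewrite mulr_ge0.
    lra.
  have : 0 <= c * w by rewrite mulr_ge0 // ltW.
  have -> : N%:R * c ^+ 2 / 4 * w = N%:R * c * (c * w) / 4 by ring.
  lra.
Qed.

(* The linear part of the resonant entry [bloch_mx v p q 0 v]; it is the opposite of
   eta_v, with q_l - q_(l+1) not yet expressed through the transform of q. *)
Definition corner : R[i] :=
  - fourier_mx (fun l => p 0 l) 0 v + fourier_mx r 0 v * cis (twist v v).

(** At the entry [(0, v)] the two hop phases coincide, which turns [half] back into the full step
    [r]. What remains is the exponential remainder [g], counted twice. *)
Lemma bloch_corner :
  normc (bloch_mx v p q 0 v - corner) <= N%:R * c ^+ 2 / 2 * weight sigma 0 v.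
Proof.
rewrite mxE hop_expansion [0 == v]eq_sym (negbTE v_neq0) add0r.
have -> : cis (- twist v (0 : 'I_N)) = cis (twist v v) :> R[i].
  by rewrite -twist_reflect subr0.
have -> : fourier_mx half 0 v = (2^-1)%:C * fourier_mx r 0 v by exact: fourier_mxZ.
have -> : fourier_mx (fun l => - p 0 l) 0 v = - fourier_mx (fun l => p 0 l) 0 v.
  have := fourier_mxZ (-1) (fun l => p 0 l) 0 v.
  rewrite (rmorphN (real_complex R)) rmorph1 mulN1r => <-.
  by congr (fourier_mx _ _ _); apply/funext => l; rewrite mulN1r.
have h2 : (2^-1)%:C * 2 = 1 :> R[i].
  rewrite -(rmorph_nat (real_complex R) 2) -real_complexM mulVf ?pnatr_eq0 //.
have -> : - fourier_mx (fun l => p 0 l) 0 v + ((2^-1)%:C * fourier_mx r 0 v + fourier_mx g 0 v) *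
   (cis (twist v v) + cis (twist v v)) - corner = fourier_mx g 0 v * (cis (twist v v) + cis (twist v v)).
  rewrite /corner.
  transitivity (fourier_mx g 0 v * (cis (twist v v) + cis (twist v v)) +
     ((2^-1)%:C * 2 - 1) * fourier_mx r 0 v * cis (twist v v)); first by ring.
  by rewrite h2 subrr !mul0r addr0.
rewrite normcM.
have -> : N%:R * c ^+ 2 / 2 * weight sigma 0 v = N%:R * c ^+ 2 / 4 * weight sigma 0 v * 2 by field.
apply: ler_pM; rewrite ?normc_ge0 //; first exact: g_le.
by apply: le_trans (normcD_le _ _) _; rewrite !normc_cis.
Qed.

End BlochSetting.

(** * Mode energies and bootstrap *)

Section ModeEnergy.
Context {R : realType} {n : nat}.
Local Notation N := n.+1.

Lemma fourier_mx_shift (f : 'I_N -> R) i j : fourier_mx f i j = fourier_mx f 0 (j - i).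
Proof.
rewrite !mxE; congr (_ * _); apply: eq_bigr => l _; congr (_ * _).
rewrite reflect_val /= subr0; set b : nat := (j < i)%N.
have -> : 2 * pi * l%:R * (j%:R - i%:R + N%:R * b%:R) / N%:R =
   2 * pi * l%:R * (j%:R - i%:R) / N%:R + 2 * pi * (l * b)%N%:R :> R.
  have N0 : (N%:R : R) != 0 by rewrite pnatr_eq0.
  rewrite natrM; move: (N%:R : R) N0 => M M0; field; exact: M0.
by rewrite cisD cis_2pi mulr1.
Qed.

Lemma cyc_dist_shift (i j : 'I_N) : cyc_dist i j = cyc_dist 0 (j - i).
Proof.
have hi := ltn_ord i; have hj := ltn_ord j.
have := reflect_val (R := R) j i; have := ltn_ord (j - i)%R; rewrite /cyc_dist.
move: (nat_of_ord (j - i)%R) => m hm.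
have -> : nat_of_ord (0 : 'I_N) = 0%N by [].
case: (ltnP j i) => h /=; rewrite ?mulr1 ?mulr0 ?addr0 => e.
- have {e} : (m + i = j + N)%N.
    by apply/eqP; rewrite -(eqr_nat R) !natrD e; apply/eqP; ring.
  lia.
- have {e} : (m + i = j)%N by apply/eqP; rewrite -(eqr_nat R) natrD e subrK.
  lia.
Qed.

Lemma weighted_le_shift (sigma c : R) (f : 'I_N -> R) :
  (forall v, normc (fourier_mx f 0 v) <= c * weight sigma 0 v) -> weighted_le sigma c f.
Proof. by move=> h i j; rewrite fourier_mx_shift /weight cyc_dist_shift. Qed.

Lemma fourier_mx00 (f : 'I_N -> R) : \sum_l f l = 0 -> fourier_mx f 0 0 = 0.
Proof.
move=> h; rewrite mxE (eq_bigr (fun l => (f l)%:C)); last first.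
  by move=> l _; rewrite subrr mulr0 mul0r cis0 mulr1.
by rewrite -(rmorph_sum (real_complex R)) h mulr0.
Qed.

Lemma fourier_mx_opp (f : 'I_N -> R) v : fourier_mx f 0 (- v) = conjc (fourier_mx f 0 v).
Proof. by rewrite -fourier_mx_herm [RHS]fourier_mx_shift sub0r. Qed.

Lemma opp_val (v : 'I_N) : v != 0 -> ((- v)%R : nat) = (N - v)%N.
Proof.
move=> v0; have hv := ltn_ord v; have v1 : (0 < v)%N by rewrite lt0n.
by rewrite /= modn_small // ltn_subrL v1.
Qed.

Implicit Types (p q : 'rV[R]_N) (v : 'I_N).
Local Notation steps q := (fun l : 'I_N => q 0 l - q 0 (ordS l)).

(** Since [twist (- v) (- v) = pi - twist v v], passing from [v] to [- v] flips the relative sign of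
    the two terms. The two corners together therefore control [p] and the steps of [q]
    separately. *)
Lemma corner_opp v p q : v != 0 ->
  corner (- v) p q = - conjc (fourier_mx (fun l => p 0 l) 0 v +
    fourier_mx (steps q) 0 v * cis (twist v v)).
Proof.
move=> v0; rewrite /corner !fourier_mx_opp conjcD conjcM conjc_cis opprD; congr (_ + _).
rewrite -mulrN; congr (_ * _).
have -> : twist (- v)%R (- v)%R = pi - twist v v :> R.
  have hv : (v <= N)%N by rewrite ltnW.
  have N0 : (N%:R : R) != 0 by rewrite pnatr_eq0.
  rewrite /twist opp_val // natrB //; move: (N%:R : R) N0 => M M0; field; exact: M0.
by rewrite cisD -{1}[pi]mulr1 (cis_pi 1) expr1 mulN1r.
Qed.

Lemma corner_pair_bound v p q K : v != 0 ->
  normc (corner v p q) <= K -> normc (corner (- v) p q) <= K ->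
  normc (fourier_mx (fun l => p 0 l) 0 v) <= K /\ normc (fourier_mx (steps q) 0 v) <= K.
Proof.
move=> v0; rewrite (corner_opp p q v0) normc_opp normc_conj /corner.
set P := fourier_mx _ 0 v; set Q := fourier_mx _ 0 v * _ => h1 h2.
have half (z : R[i]) : normc (z + z) <= 2 * K -> normc z <= K.
  have -> : z + z = (2 : R)%:C * z.
    by rewrite (rmorph_nat (real_complex R) 2) mulr_natl mulr2n.
  by rewrite normcM normc_real normr_nat ler_pM2l.
split.
- apply: half; have -> : P + P = (P + Q) - (- P + Q) by ring.
  apply: le_trans (normcD_le _ _) _; rewrite normc_opp; lra.
- have -> : normc (fourier_mx (steps q) 0 v) = normc Q by rewrite /Q normcM normc_cis mulr1.
  apply: half; have -> : Q + Q = (P + Q) + (- P + Q) by ring.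
  by apply: le_trans (normcD_le _ _) _; lra.
Qed.

Lemma normc_parallelogram (z w : R[i]) :
  normc (- z + w) ^+ 2 + normc (z + w) ^+ 2 = 2 * (normc z ^+ 2 + normc w ^+ 2).
Proof. by rewrite !normc_sqr; case: z => a b; case: w => c d /=; ring. Qed.

Lemma fourier_dft (u : 'rV[R]_N) v :
  normc (fourier_mx (fun l => u 0 l) 0 v) ^+ 2 = normc (dft u v) ^+ 2 / N%:R.
Proof.
rewrite mxE /dft !normcM !normc_real.
have -> : \sum_(l < N) (u 0 l)%:C * cis (2 * pi * l%:R * (v%:R - (nat_of_ord (0%R : 'I_N))%:R) / N%:R) =
    \sum_(j < N) (u 0 j)%:C * cis (2 * pi * j%:R * v%:R / N%:R) :> R[i].
  by apply: eq_bigr => l _; rewrite subr0.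
have N0 : 0 < N%:R :> R by rewrite ltr0n.
have s2 : Num.sqrt N%:R ^+ 2 = N%:R :> R by rewrite sqr_sqrtr // ltW.
rewrite !exprMn !ger0_norm ?invr_ge0 ?sqrtr_ge0 ?ltW // ![(_^-1) ^+ 2]exprVn s2.
by field; rewrite gt_eqF.
Qed.

(** The cyclic difference multiplies the mode [v] by [1 - cis (- 2 pi v / N)], of modulus
    [2 |sin (pi v / N)|]. *)
Lemma fourier_steps (q : 'rV[R]_N) v :
  normc (fourier_mx (steps q) 0 v) ^+ 2 =
  mode_frequency R N v ^+ 2 * normc (fourier_mx (fun l => q 0 l) 0 v) ^+ 2.
Proof.
have -> : fourier_mx (steps q) 0 v =
    fourier_mx (fun l => q 0 l) 0 v * (1 - cis (- (2 * pi * v%:R / N%:R))).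
  have -> : fourier_mx (steps q) 0 v =
      fourier_mx (fun l => q 0 l) 0 v - fourier_mx (fun l => q 0 (ordS l)) 0 v.
    apply/eqP; rewrite eq_sym subr_eq -fourier_mxD; apply/eqP.
    by congr (fourier_mx _ 0 v); apply/funext => l; rewrite subrK.
  rewrite mulrBr mulr1; congr (_ - _); rewrite !mxE -[RHS]mulrA; congr (_ * _).
  rewrite mulr_suml [RHS](reindex_inj (@ordS_inj N)) /=; apply: eq_bigr => l _.
  rewrite -[RHS]mulrA -cisD; congr (_ * _); rewrite subr0.
  have N0 : (N%:R : R) != 0 by rewrite pnatr_eq0.
  have [eN|lN] := eqVneq l.+1 N.
  - have -> : (l.+1 %% N)%N = 0%N by rewrite eN modnn.
    have -> : 2 * pi * l%:R * v%:R / N%:R = 2 * pi * 0%:R * v%:R / N%:R -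
        2 * pi * v%:R / N%:R + 2 * pi * v%:R :> R.
      have -> : (l : nat)%:R = N%:R - 1 :> R by rewrite -[in RHS]eN -natr1 addrK.
      move: (N%:R : R) N0 => M M0; field; exact: M0.
    by rewrite [LHS]cisD cis_2pi mulr1.
  - have -> : (l.+1 %% N)%N = l.+1 by rewrite modn_small // ltn_neqAle lN ltn_ord.
    by congr cis; rewrite -natr1; ring.
rewrite normcM exprMn mulrC; congr (_ * _).
rewrite normc_sqr /cis /= cosN sinN opprK add0r.
have -> : 2 * pi * v%:R / N%:R = v%:R * pi / N%:R *+ 2 :> R by rewrite -mulr_natr; ring.
rewrite cos_mulr2n sin_mulr2n /mode_frequency.
have := cos2Dsin2 (v%:R * pi / N%:R : R).
move: (cos _) (sin _) => c s h.
have -> : (1 - (c ^+ 2 *+ 2 - 1)) ^+ 2 + (c * s *+ 2) ^+ 2 = 4 * (1 - c ^+ 2) ^+ 2 + 4 * c ^+ 2 * s ^+ 2.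
  by rewrite -[c ^+ 2 *+ 2]mulr_natr -[c * s *+ 2]mulr_natr; ring.
have -> : 1 - c ^+ 2 = s ^+ 2 by lra.
have -> : c ^+ 2 = 1 - s ^+ 2 by lra.
ring.
Qed.

Lemma corner_energy v p q : v != 0 ->
  normc (corner v p q) ^+ 2 + normc (corner (- v) p q) ^+ 2 = 4 * specific_energy p q v.
Proof.
move=> v0; rewrite (corner_opp p q v0) normc_opp normc_conj /corner normc_parallelogram.
rewrite normcM normc_cis mulr1 fourier_steps !fourier_dft /specific_energy /mode_energy.
by move: (mode_frequency _ _ _) N%:R^-1 => om M; field.
Qed.

End ModeEnergy.

(** * A continuity argument with a forbidden interval *)

Section Bootstrap.
Context {R : realType}.

Lemma continuous_bigsum (I : Type) (s : seq I) (F : I -> R -> R) :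
  (forall i, continuous (F i)) -> continuous (fun t => \sum_(i <- s) F i t).
Proof.
move=> hF t; elim: s => [|i s IH].
  have -> : (fun t => \sum_(i <- [::]) F i t) = cst 0 by apply/funext => z; rewrite big_nil.
  exact: cvg_cst.
have -> : (fun t => \sum_(j <- i :: s) F j t) = (fun t => F i t + \sum_(j <- s) F j t).
  by apply/funext => z; rewrite big_cons.
by apply: cvgD => //; exact: hF.
Qed.

(* The sum of the positive parts of [x i - a] takes no value in ]0, b - a], so it
   vanishes identically by the intermediate value theorem. *)
Lemma continuity_bootstrap (I : finType) (x : I -> R -> R) (a b : R) : a < b ->
  (forall i, continuous (x i)) -> (forall i, x i 0 <= a) ->
  (forall t, (forall i, x i t <= b) -> forall i, x i t <= a) ->
  forall t i, x i t <= a.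
Proof.
move=> ab xc x0 gap t i.
pose y i t := (`|x i t - a| + (x i t - a)) / 2.
have y_ge0 j s : 0 <= y j s.
  by rewrite divr_ge0 //; have := ler_norm (- (x j s - a)); rewrite normrN; lra.
have y_gex j s : x j s - a <= y j s by rewrite /y; have := ler_norm (x j s - a); lra.
pose F s := \sum_j y j s.
have F_ge0 s : 0 <= F s by apply: sumr_ge0.
have yF j s : y j s <= F s.
  by rewrite /F (bigD1 j) //= lerDl sumr_ge0.
have F_gap s : F s <= b - a -> F s = 0.
  move=> hF; rewrite /F big1 // => j _.
  have hx k : x k s <= b by have := y_gex k s; have := yF k s; lra.
  have := gap s hx j; rewrite -subr_le0 => h.
  by rewrite /y ler0_norm // addNr mul0r.
have F_cont : continuous F.
  apply: continuous_bigsum => j s.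
  have c1 : {for s, continuous (fun s => x j s - a)}.
    by apply: cvgB; [exact: xc|exact: cvg_cst].
  apply: cvgM; last exact: cvg_cst.
  by apply: cvgD => //; apply: cvg_norm.
have F0 : F 0 = 0.
  apply: F_gap; rewrite /F big1 ?subr_ge0 ?ltW // => j _.
  by have := x0 j; rewrite -subr_le0 => h; rewrite /y ler0_norm // addNr mul0r.
suff Ft : F t = 0.
  have := y_gex i t; have := yF i t; rewrite Ft; lra.
have [/F_gap //|hF] := leP (F t) (b - a).
have mid (u v : R) : u <= v -> Num.min (F u) (F v) <= 0 -> b - a <= Num.max (F u) (F v) ->
    exists c, F c = (b - a) / 2.
  move=> uv h1 h2; have [||c _ hc] := @IVT R F u v ((b - a) / 2) uv.
  - exact: continuous_subspaceT.
  - by apply/andP; split; [apply: le_trans h1 _|apply: le_trans _ h2]; lra.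
  by exists c.
have [c hc] : exists c, F c = (b - a) / 2.
  case: (leP 0 t) => ht.
  - by apply: mid ht _ _; rewrite F0 ?ge_min ?lexx // le_max (ltW hF) orbT.
  - by apply: mid (ltW ht) _ _; rewrite F0 ?ge_min ?lexx ?orbT // le_max (ltW hF).
by have : F c = 0 by [apply: F_gap; rewrite hc; lra]; rewrite hc; lra.
Qed.

End Bootstrap.

(** * Continuity in time of the corners *)

Section Continuity.
Context {R : realType} {n : nat}.
Local Notation N := n.+1.

Lemma sum_Complex (I : Type) (s : seq I) (a b : I -> R) :
  \sum_(i <- s) (a i +i* b i) = (\sum_(i <- s) a i) +i* (\sum_(i <- s) b i).
Proof. by elim/big_rec3: _ => // i x y z _ ->. Qed.

Lemma continuous_fourier (f : R -> 'I_N -> R) i j :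
  (forall l, continuous (fun t => f t l)) ->
  continuous (fun t => complex.Re (fourier_mx (f t) i j)) /\
  continuous (fun t => complex.Im (fourier_mx (f t) i j)).
Proof.
move=> hf; pose th (l : 'I_N) : R := 2 * pi * l%:R * (j%:R - i%:R) / N%:R.
have E t : fourier_mx (f t) i j =
    (\sum_(l < N) N%:R^-1 * (f t l * cos (th l))) +i* (\sum_(l < N) N%:R^-1 * (f t l * sin (th l))).
  rewrite mxE mulr_sumr -sum_Complex; apply: eq_bigr => l _.
  by rewrite -/(th l) /cis; congr Complex; rewrite !mul0r ?subr0 ?addr0 /= ?mulr0 ?subr0 ?addr0.
split.
- rewrite (_ : (fun t => _) = (fun t => \sum_(l < N) N%:R^-1 * (f t l * cos (th l)))); last first.
    by apply/funext => t; rewrite E.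
  apply: continuous_bigsum => l t; apply: cvgM; first exact: cvg_cst.
  by apply: cvgM; [exact: hf|exact: cvg_cst].
- rewrite (_ : (fun t => _) = (fun t => \sum_(l < N) N%:R^-1 * (f t l * sin (th l)))); last first.
    by apply/funext => t; rewrite E.
  apply: continuous_bigsum => l t; apply: cvgM; first exact: cvg_cst.
  by apply: cvgM; [exact: hf|exact: cvg_cst].
Qed.

Lemma continuous_corner (v : 'I_N) (p q : R -> 'rV[R]_N) :
  (forall l, continuous (fun t => p t 0 l)) -> (forall l, continuous (fun t => q t 0 l)) ->
  continuous (fun t => normc (corner v (p t) (q t)) ^+ 2).
Proof.
move=> hp hq.
have hr l : continuous (fun t => q t 0 l - q t 0 (ordS l)).
  by move=> t; apply: cvgB; exact: hq.
have [pRe pIm] := continuous_fourier (f := fun t l => p t 0 l) 0 v hp.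
have [rRe rIm] := continuous_fourier (f := fun t l => q t 0 l - q t 0 (ordS l)) 0 v hr.
set th : R := twist v v.
pose P t := fourier_mx (fun l => p t 0 l) 0 v.
pose Q t := fourier_mx (fun l => q t 0 l - q t 0 (ordS l)) 0 v.
pose X t := - complex.Re (P t) + (complex.Re (Q t) * cos th - complex.Im (Q t) * sin th).
pose Y t := - complex.Im (P t) + (complex.Re (Q t) * sin th + complex.Im (Q t) * cos th).
have cX : continuous X.
  move=> t; apply: cvgD; first by apply: cvgN; exact: pRe.
  by apply: cvgB; apply: cvgM; [exact: rRe|exact: cvg_cst|exact: rIm|exact: cvg_cst].
have cY : continuous Y.
  move=> t; apply: cvgD; first by apply: cvgN; exact: pIm.
  by apply: cvgD; apply: cvgM; [exact: rRe|exact: cvg_cst|exact: rIm|exact: cvg_cst].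
have -> : (fun t => normc (corner v (p t) (q t)) ^+ 2) = (fun t => X t * X t + Y t * Y t).
  apply/funext => t; rewrite normc_sqr /corner /X /Y /cis -/th -/(P t) -/(Q t) !expr2.
  by case: (P t) => a b; case: (Q t) => c d.
by move=> t; apply: cvgD; apply: cvgM; [exact: cX|exact: cX|exact: cY|exact: cY].
Qed.

Lemma is_derive_continuous (f : R -> R) (f' : R -> R) :
  (forall t : R, is_derive t 1 f (f' t)) -> continuous f.
Proof.
move=> hf t; apply: differentiable_continuous; apply/derivable1_diffP.
by have [] := hf t.
Qed.

End Continuity.

(** * Localization is propagated by the flow *)

Section EnergyLocalization.
Context {R : realType} {n : nat}.
Local Notation N := n.+1.
Variables (sigma : R) (p q : R -> 'rV[R]_N).
Hypothesis sigma_ge0 : 0 <= sigma.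
Hypothesis sol : hamilton_solution (@toda_hamiltonian R N) p q.
Hypothesis sum_p : \sum_(j < N) p 0 0 j = 0.

Local Notation loc c t :=
  (forall v : 'I_N, v != 0 -> normc (corner v (p t) (q t)) <= c * weight sigma 0 v).

Lemma weight_opp (v : 'I_N) : weight sigma 0 (- v) = weight sigma 0 v.
Proof. by rewrite /weight -(cyc_distC v 0) (@cyc_dist_shift R _ v 0) sub0r. Qed.

(** The corners at [v] and [- v] control the nonzero modes; the zero modes vanish by conservation of
    momentum and because the steps telescope around the ring. *)
Lemma localized_weighted (c t : R) : 0 <= c -> loc c t ->
  weighted_le sigma c (fun l => p t 0 l) /\
  weighted_le sigma c (fun l => q t 0 l - q t 0 (ordS l)).
Proof.
move=> c0 hloc.
have h v : v != 0 -> normc (fourier_mx (fun l => p t 0 l) 0 v) <= c * weight sigma 0 v /\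
    normc (fourier_mx (fun l => q t 0 l - q t 0 (ordS l)) 0 v) <= c * weight sigma 0 v.
  move=> v0; apply: corner_pair_bound => //; first exact: hloc.
  by rewrite -weight_opp; apply: hloc; rewrite oppr_eq0.
have z0 : 0 <= c * weight sigma 0 (0 : 'I_N) by rewrite mulr_ge0 // ltW // weight_gt0.
split; apply: weighted_le_shift => v; have [->|/h[]//] := eqVneq v 0.
- by rewrite fourier_mx00 ?ComplexField.Normc.normc0 // (toda_momentum sol).
- rewrite fourier_mx00 ?ComplexField.Normc.normc0 // sumrB.
  by rewrite [X in X - _](reindex_inj (@ordS_inj N)) subrr.
Qed.

(** [gap_comparison] costs [16 (3 c) ^ 2 N ^ 2 / 4 = 36 c ^ 2 N ^ 2]. Replacing the matrix entry by
    the corner at both times costs [N c ^ 2], at most one more [c ^ 2 N ^ 2]. *)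
Lemma corner_stability (c t : R) (v : 'I_N) : 0 <= c -> 6 * c * N%:R ^+ 2 <= 1 ->
  loc c 0 -> loc c t -> v != 0 ->
  normc (corner v (p t) (q t)) <=
  normc (corner v (p 0) (q 0)) + 37 * (c ^+ 2 * N%:R ^+ 2) * weight sigma 0 v.
Proof.
move=> c0 cs l0 lt v0.
have [p0 r0] := localized_weighted c0 l0; have [pt rt] := localized_weighted c0 lt.
have g0 := bloch_gap_setting sigma_ge0 v0 c0 cs p0 r0.
have gt := bloch_gap_setting sigma_ge0 v0 c0 cs pt rt.
have hdet (lam : R) : \det (bloch_mx v (p 0) (q 0) - lam%:C%:M) =
    \det (bloch_mx v (p t) (q t) - lam%:C%:M).
  by rewrite !bloch_det [in RHS](toda_lax_det sol).
have cmp := gap_comparison g0 gt hdet.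
have e0 := bloch_corner (p 0) sigma_ge0 v0 c0 cs r0.
have et := bloch_corner (p t) sigma_ge0 v0 c0 cs rt.
have w0 : 0 < weight sigma 0 v := weight_gt0 _ _ _.
have d0 := le_trans (normc_dist _ _) e0; have dt := le_trans (normc_dist _ _) et.
have hN : N%:R * c ^+ 2 * weight sigma 0 v <= c ^+ 2 * N%:R ^+ 2 * weight sigma 0 v.
  rewrite ler_wpM2r ?(ltW w0) // mulrC ler_wpM2l ?sqr_ge0 // expr2 ler_peMr //.
  by rewrite ler1n.
move: cmp d0 dt hN.
have -> : 16 * ((3 * c) ^+ 2 * (N%:R ^+ 2 / 4) * weight sigma 0 v) =
  36 * (c ^+ 2 * N%:R ^+ 2 * weight sigma 0 v) by field.
rewrite -[37 * _ * _]mulrA !ler_norml [_ / 2 * _]mulrAC.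
move: (c ^+ 2 * N%:R ^+ 2 * _) (N%:R * c ^+ 2 * _) => x y.
move: (normc (bloch_mx _ _ _ _ _)) (normc (bloch_mx _ _ _ _ _)) => B0 Bt.
move: (normc _) (normc _) => C0 Ct; lra.
Qed.

(** In units of [N ^ -2] the corners start below [2 r]. While they stay below [4 r],
    [corner_stability] with [c = 4 r / N ^ 2] adds at most [K r ^ 2 <= r], which puts them below
    [3 r]. In [K], [37] is the constant of that lemma and [16] comes from [c ^ 2]. *)
Lemma corner_bootstrap (K r : R) : K = 37 * 16 -> 0 < r -> K * r <= 1 ->
  loc (2 * r / N%:R ^+ 2) 0 ->
  forall t (v : 'I_N), v != 0 -> normc (corner v (p t) (q t)) <=
    normc (corner v (p 0) (q 0)) + K * r ^+ 2 / N%:R ^+ 2 * weight sigma 0 v.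
Proof.
move=> KE r0 rs l0.
have N0 : 0 < N%:R ^+ 2 :> R by rewrite exprn_gt0 // ltr0n.
have r24 : 24 * r <= 1 by move: rs; rewrite KE; lra.
set m : R := N%:R ^- 2.
have m0 : 0 < m by rewrite invr_gt0.
have Nm : N%:R ^+ 2 * m = 1 by rewrite mulfV ?gt_eqF.
have w0 v : 0 < weight sigma 0 v := weight_gt0 _ _ _.
have locW c c' t : c <= c' -> loc c t -> loc c' t.
  by move=> cc' h v v0; apply: le_trans (h v v0) _; rewrite ler_wpM2r // ltW.
have step t : loc (4 * r * m) t -> forall v : 'I_N, v != 0 ->
    normc (corner v (p t) (q t)) <=
    normc (corner v (p 0) (q 0)) + K * r ^+ 2 * m * weight sigma 0 v.
  move=> lt v v0.
  have c0 : 0 <= 4 * r * m by rewrite !mulr_ge0 // ltW.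
  have cs : 6 * (4 * r * m) * N%:R ^+ 2 <= 1.
    have -> : 6 * (4 * r * m) * N%:R ^+ 2 = 24 * r * (N%:R ^+ 2 * m) by ring.
    by rewrite Nm mulr1.
  have l0' : loc (4 * r * m) 0.
    by apply: locW l0; rewrite -/m ler_wpM2r ?(ltW m0) //; lra.
  have := corner_stability c0 cs l0' lt v0.
  have -> : 37 * ((4 * r * m) ^+ 2 * N%:R ^+ 2) = K * r ^+ 2 * m * (N%:R ^+ 2 * m).
    by rewrite KE; ring.
  by rewrite Nm mulr1.
pose x (v : 'I_N) t := if v == 0 then 0 else
  normc (corner v (p t) (q t)) ^+ 2 / weight sigma 0 v ^+ 2.
have xE c t : 0 <= c -> (forall v, x v t <= c ^+ 2) <-> loc c t.
  move=> c0; have key v : v != 0 -> (x v t <= c ^+ 2) =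
      (normc (corner v (p t) (q t)) <= c * weight sigma 0 v).
    move=> v0; rewrite /x (negbTE v0) ler_pdivrMr ?exprn_gt0 // -exprMn.
    by rewrite ler_sqr ?nnegrE ?normc_ge0 ?mulr_ge0 // ltW.
  split=> h v; first by move=> v0; rewrite -key.
  by have [->|v0] := eqVneq v 0; [rewrite /x eqxx sqr_ge0|rewrite key // h].
have rm0 : 0 < r * m by rewrite mulr_gt0.
have x_cont v : continuous (x v).
  rewrite /x; have [_|v0] := eqVneq v 0; first by move=> t; exact: cvg_cst.
  move=> t; apply: cvgM; last exact: cvg_cst.
  apply: continuous_corner => l; first exact: is_derive_continuous (toda_p' sol ^~ l).
  exact: is_derive_continuous (toda_q' sol ^~ l).
have m3 : 0 <= 3 * r * m by rewrite !mulr_ge0 // ltW.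
have m4 : 0 <= 4 * r * m by rewrite !mulr_ge0 // ltW.
have ab : (3 * r * m) ^+ 2 < (4 * r * m) ^+ 2.
  by rewrite ltr_sqr ?nnegrE // -!mulrA ltr_pM2r //; lra.
have loc3 : forall t, loc (4 * r * m) t.
  suff loc3 : forall t v, x v t <= (3 * r * m) ^+ 2.
    by move=> t; apply: (locW (3 * r * m)); [rewrite -!mulrA ler_pM2r //; lra|exact/xE].
  apply: (continuity_bootstrap ab x_cont).
    apply/xE => //; apply: locW l0; rewrite -/m -!mulrA ler_pM2r //; lra.
  move=> t /(xE _ _ m4) lt; apply/xE => // v v0.
  apply: le_trans (step t lt v v0) _; have := l0 v v0.
  rewrite -/m.
  have h : K * r ^+ 2 * m * weight sigma 0 v <= r * m * weight sigma 0 v.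
    apply: ler_wpM2r; first exact: ltW.
    apply: ler_wpM2r; first exact: ltW.
    by rewrite expr2 mulrA ler_piMl // ltW.
  move=> h0.
  have e2 : 2 * r * m * weight sigma 0 v = 2 * (r * m * weight sigma 0 v) by ring.
  have e3 : 3 * r * m * weight sigma 0 v = 3 * (r * m * weight sigma 0 v) by ring.
  rewrite e2 in h0; rewrite e3; lra.
by move=> t v v0; exact: (step t (loc3 t) v v0).
Qed.

End EnergyLocalization.

(** * From the corners back to the energies *)

Unset Implicit Arguments.

Theorem corollary1p12 (R : realType) (sigma : R) (sigma_gt0 : 0 < sigma) :
  exists R0 C1 : R, 0 < R0 /\ 0 < C1 /\
    forall (N : nat) (r : R) (p q : R -> 'rV[R]_N),
      (2 <= N)%N ->
      0 < r -> r < R0 ->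
      hamilton_solution (@toda_hamiltonian R N) p q ->
      \sum_(j < N) q 0 0 j = 0 ->
      \sum_(j < N) p 0 0 j = 0 ->
      let mu : R := N%:R^-1 in
      specific_energy (p 0) (q 0) 1 = r ^+ 2 * expR (- 2 * sigma) * mu ^+ 4 ->
      specific_energy (p 0) (q 0) (N - 1)
        = r ^+ 2 * expR (- 2 * sigma) * mu ^+ 4 ->
      (forall k : nat, (1 <= k <= N - 1)%N -> k <> 1%N -> k <> (N - 1)%N ->
        specific_energy (p 0) (q 0) k = 0) ->
      forall (k : nat) (t : R), (1 <= k <= N %/ 2)%N ->
        specific_energy (p t) (q t) k
          <= r ^+ 2 * (1 + C1 * r) * mu ^+ 4 * expR (- 2 * sigma * k%:R).
Proof.
have half_range (m k : nat) : (1 <= k <= m.+1 %/ 2)%N -> (1 < m.+1)%N ->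
    [/\ (k < m.+1)%N, minn k (m.+1 - k) = k &
        k != 1%N -> [/\ (1 <= k <= m.+1 - 1)%N, k <> 1%N & k <> (m.+1 - 1)%N]].
  by move=> ? ?; split=> [||?]; [lia|lia|split; lia].
have edge_dist (m k : nat) : (1 < m.+1)%N -> (k = 1 \/ k = m.+1 - 1)%N ->
    minn k (m.+1 - k) = 1%N by lia.
have inner_range (m k : nat) : (0 < k)%N -> (k < m.+1)%N -> (1 <= k <= m.+1 - 1)%N by lia.
have [K KE] : exists K : R, K = 37 * 16 by exists (37 * 16).
have K0 : 0 < K by rewrite KE mulr_gt0 ?ltr0n.
(* [1 / K] is the smallness required by the bootstrap. With [z = mu ^ 2] times the weight, each of
   the two squared corners grows by at most [5 K r (r z) ^ 2], and their sum is four times the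
   energy: [10 / 4 <= 3]. *)
exists K^-1, (3 * K); split; first by rewrite invr_gt0.
split; first by rewrite mulr_gt0 ?ltr0n.
move=> [? ? ? //|n] r p q N2 r0 rR0 sol _ sum_p mu E1 EN1 Eother k t kN.
have rs : K * r <= 1 by rewrite -ler_pdivlMl // mulr1 ltW.
have sg := ltW sigma_gt0.
have mu0 : 0 < mu by rewrite /mu invr_gt0 ltr0n.
have muE : mu ^+ 2 = n.+1%:R ^- 2 by rewrite /mu exprVn.
have w0 (v : 'I_n.+1) : 0 < weight sigma 0 v := weight_gt0 _ _ _.
have weightE (v : 'I_n.+1) m : cyc_dist 0 v = m -> weight sigma 0 v = expR (- sigma * m%:R).
  by move=> <-.
have cdE (v : 'I_n.+1) : cyc_dist 0 v = minn v (n.+1 - v).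
  by rewrite /cyc_dist sub0n subn0.
have corner_le (s : R) (v : 'I_n.+1) e : v != 0 -> 0 <= e ->
    4 * specific_energy (p s) (q s) v <= e ^+ 2 -> normc (corner v (p s) (q s)) <= e.
  move=> v0 e0 h; rewrite -ler_sqr ?nnegrE ?normc_ge0 //; apply: le_trans h.
  by rewrite -corner_energy // lerDl sqr_ge0.
have loc0 (v : 'I_n.+1) : v != 0 ->
    normc (corner v (p 0) (q 0)) <= 2 * r / n.+1%:R ^+ 2 * weight sigma 0 v.
  move=> v0; have v1 : (0 < v)%N by rewrite lt0n.
  have hv := ltn_ord v.
  have rm0 : 0 <= 2 * r / n.+1%:R ^+ 2 by rewrite -muE !mulr_ge0 ?sqr_ge0 // ltW.
  apply: corner_le => //; first by rewrite mulr_ge0 // ltW.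
  (* Both excited modes are at cyclic distance [1], where this bound is an equality. *)
  have edge : ((v : nat) = 1 \/ (v : nat) = n.+1 - 1)%N ->
      4 * specific_energy (p 0) (q 0) v <= (2 * r / n.+1%:R ^+ 2 * weight sigma 0 v) ^+ 2.
    move=> hve; have -> : specific_energy (p 0) (q 0) v = r ^+ 2 * expR (- 2 * sigma) * mu ^+ 4.
      by case: hve => ->.
    rewrite (weightE v 1%N); last by rewrite cdE edge_dist.
    have -> : expR (- 2 * sigma) = expR (- sigma * 1%:R) ^+ 2.
      by rewrite -expRM_natl; congr expR; ring.
    rewrite -muE; move: (expR _) => w.
    by rewrite le_eqVlt; apply/orP; left; apply/eqP; ring.
  have [e1|n1] := eqVneq (v : nat) 1%N; first by apply: edge; left.
  have [e2|n2] := eqVneq (v : nat) (n.+1 - 1)%N; first by apply: edge; right.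
  by rewrite (Eother v (inner_range n v v1 hv) (elimN eqP n1) (elimN eqP n2)) mulr0 sqr_ge0.
have step := corner_bootstrap sg sol sum_p KE r0 rs loc0.
have [kn kmin kinner] := half_range n k kN N2.
pose v : 'I_n.+1 := Ordinal kn.
have v0 : v != 0 by rewrite -val_eqE /= -lt0n; case/andP: kN.
have nv0 : - v != 0 by rewrite oppr_eq0.
have wE : weight sigma 0 v = expR (- sigma * k%:R).
  by apply: weightE; rewrite cdE.
have -> : expR (- 2 * sigma * k%:R) = weight sigma 0 v ^+ 2.
  by rewrite wE -expRM_natl; congr expR; ring.
have E0 : specific_energy (p 0) (q 0) k <= (r * mu ^+ 2 * weight sigma 0 v) ^+ 2.
  have [k1|k1] := eqVneq k 1%N.
    rewrite wE k1 E1.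
    have -> : expR (- 2 * sigma) = expR (- sigma * 1%:R) ^+ 2.
      by rewrite -expRM_natl; congr expR; ring.
    by move: (expR _) => w; rewrite le_eqVlt; apply/orP; left; apply/eqP; ring.
  by have [k2 k3 k4] := kinner k1; rewrite (Eother k k2 k3 k4) sqr_ge0.
have h1 := step t v v0; have h2 := step t (- v) nv0.
have i1 := loc0 v v0; have i2 := loc0 (- v) nv0.
rewrite weight_opp in h2 i2.
have sum0 := corner_energy (p 0) (q 0) v0; have sumt := corner_energy (p t) (q t) v0.
rewrite -muE in h1 h2 i1 i2.
have a0 := normc_ge0 (corner v (p 0) (q 0)); have b0 := normc_ge0 (corner (- v) (p 0) (q 0)).
have at0 := normc_ge0 (corner v (p t) (q t)); have bt0 := normc_ge0 (corner (- v) (p t) (q t)).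
set z := mu ^+ 2 * weight sigma 0 v.
have z0 : 0 < z by rewrite mulr_gt0 // exprn_gt0.
have r2 : 0 <= r * (r * z) ^+ 2 by rewrite mulr_ge0 ?sqr_ge0 // ltW.
(* In units of [K r (r z) ^ 2], the cross term of the square contributes [2 * 2] and the last term,
   by [K r <= 1], at most [1]. *)
have grow (a b : R) : 0 <= a -> 0 <= b -> a <= 2 * (r * z) -> b <= a + K * r ^+ 2 * z ->
    b ^+ 2 <= a ^+ 2 + 5 * (K * (r * (r * z) ^+ 2)).
  move=> ha hb ha2 hb2; have e0 : 0 <= K * r ^+ 2 * z.
    by rewrite mulr_ge0 ?(ltW z0) // mulr_ge0 ?sqr_ge0 // ltW.
  apply: le_trans (_ : (a + K * r ^+ 2 * z) ^+ 2 <= _).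
    by rewrite ler_sqr ?nnegrE ?addr_ge0.
  have cross : a * (K * r ^+ 2 * z) <= 2 * (K * (r * (r * z) ^+ 2)).
    have -> : 2 * (K * (r * (r * z) ^+ 2)) = 2 * (r * z) * (K * r ^+ 2 * z) by ring.
    by rewrite ler_wpM2r.
  have square : (K * r ^+ 2 * z) ^+ 2 <= K * (r * (r * z) ^+ 2).
    have -> : (K * r ^+ 2 * z) ^+ 2 = K * r * (K * (r * (r * z) ^+ 2)) by ring.
    by rewrite ler_piMl // mulr_ge0 // ltW.
  by rewrite sqrrD; move: cross square; clear; lra.
have g1 := grow _ _ a0 at0; have g2 := grow _ _ b0 bt0.
have -> : r ^+ 2 * (1 + 3 * K * r) * mu ^+ 4 * weight sigma 0 v ^+ 2 =
    (r * z) ^+ 2 + 3 * (K * (r * (r * z) ^+ 2)) by rewrite /z; ring.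
have {}r2 : 0 <= K * (r * (r * z) ^+ 2) by rewrite mulr_ge0 // ltW.
have zE (c : R) : c * mu ^+ 2 * weight sigma 0 v = c * z by rewrite /z mulrA.
have {}E0 : specific_energy (p 0) (q 0) v <= (r * z) ^+ 2 by rewrite -zE.
rewrite !zE in h1 h2 i1 i2; rewrite -[2 * r * z]mulrA in i1 i2.
have {}g1 := g1 i1 h1; have {}g2 := g2 i2 h2.
have -> : specific_energy (p t) (q t) k = specific_energy (p t) (q t) v by [].
move: E0 g1 g2 sum0 sumt r2; clear; lra.
Qed.
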